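(* Let $c\colon Q\to G$ be a continuous homomorphism of an amenable $r$-discrete Hausdorff groupoid $Q$ into a discrete group $G$, and let $\beta$ be the action of $G$ on $C^*(Q\times_cG)$ determined by $\beta_s(f)(x,t)=f(x,ts)$ for $s,t\in G$, $f\in C_c(Q\times_cG)$, $x\in Q$. Then the full crossed product satisfies $$C^*(Q\times_cG)\times_\beta G\cong C^*(Q)\otimes\mathcal{K}(\ell^2(G)).$$
   Context: Groupoids are locally compact topological groupoids. A groupoid $Q$ is $r$-discrete if its range map $r$ is a local homeomorphism onto the unit space $Q^0$ (so counting measures on the sets $Q^u=r^{-1}(u)$ give a Haar system). Amenability of $Q$ is topological amenability in the sense of Renault and Anantharaman-Delaroche: there is a net $(g_i)$ of nonnegative functions in $C_c(Q)$ with $\sum_{x\in Q^u}g_i(x)\le 1$ for all $u\in Q^0$, $\sum_{x\in Q^u}g_i(x)\to1$ uniformly on compact subsets of $Q^0$, and $\sum_{y\in Q^{r(x)}}|g_i(x^{-1}y)-g_i(y)|\to0$ uniformly for $x$ in compact subsets of $Q$. $C_c(Q)$ is a $^*$-algebra with $(fg)(x)=\sum_{r(y)=r(x)}f(y)g(y^{-1}x)$ and $f^*(x)=\overline{f(x^{-1})}$, and $C^*(Q)$, the full groupoid $C^*$-algebra, is the enveloping $C^*$-algebra of $C_c(Q)$. The skew-product groupoid $Q\times_cG$ is the set $Q\times G$ with the product topology and operations $(x,c(y)s)(y,s)=(xy,s)$ for composable $(x,y)$ and $s\in G$, and $(x,s)^{-1}=(x^{-1},c(x)s)$; it is $r$-discrete.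 $\beta$ is induced by the action $s\cdot(x,t)=(x,ts^{-1})$ of $G$ on $Q\times_cG$. $\mathcal{K}(\ell^2(G))$ denotes the compact operators on $\ell^2(G)$. *)

(* Defs.v *)
From HB Require Import structures.
From mathcomp Require Import all_boot all_order all_algebra.
From mathcomp Require Import all_classical all_reals all_analysis.
From mathcomp Require Import complex ring.
From mathcomp Require summability.

Set Implicit Arguments.
Unset Strict Implicit.
Unset Printing Implicit Defensive.

Import Order.TTheory GRing.Theory Num.Theory.
Import numFieldNormedType.Exports.

Local Open Scope classical_set_scope.
Local Open Scope ring_scope.
Local Open Scope complex_scope.

Local Notation normc := Normc.normc.

(* The complex numbers are R[i]; R[i]^o is the same type carrying its norm
   topology. *)

(* The product [gmul x y] is meaningful only when [gsrc x = grng y]; outside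
   composable pairs its value is irrelevant.  The unit space is a subset of the
   groupoid, [grng x = x x^-1] and [gsrc x = x^-1 x]. *)
Record groupoid (Q : Type) := Groupoid {
  grng : Q -> Q;
  gsrc : Q -> Q;
  gmul : Q -> Q -> Q;
  ginv : Q -> Q;
  grng_rng : forall x, grng (grng x) = grng x;
  gsrc_rng : forall x, gsrc (grng x) = grng x;
  grng_src : forall x, grng (gsrc x) = gsrc x;
  gsrc_src : forall x, gsrc (gsrc x) = gsrc x;
  grngM : forall x y, gsrc x = grng y -> grng (gmul x y) = grng x;
  gsrcM : forall x y, gsrc x = grng y -> gsrc (gmul x y) = gsrc y;
  gmulA : forall x y z, gsrc x = grng y -> gsrc y = grng z ->
    gmul x (gmul y z) = gmul (gmul x y) z;
  gmul_rng : forall x, gmul (grng x) x = x;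
  gmul_src : forall x, gmul x (gsrc x) = x;
  grngV : forall x, grng (ginv x) = gsrc x;
  gsrcV : forall x, gsrc (ginv x) = grng x;
  gmulV : forall x, gmul x (ginv x) = grng x;
  gmulVx : forall x, gmul (ginv x) x = gsrc x
}.

Definition gunits (Q : Type) (X : groupoid Q) : set Q := range (grng X).

Definition gfiber (Q : Type) (X : groupoid Q) (u : Q) : set Q :=
  [set x | grng X x = u].

Definition topological_groupoid (Q : topologicalType) (X : groupoid Q) : Prop :=
  {within [set p : Q * Q | gsrc X p.1 = grng X p.2],
     continuous (fun p : Q * Q => gmul X p.1 p.2)}
  /\ continuous (ginv X).

Definition local_homeomorphism_onto (Q S : topologicalType) (f : Q -> S)
    (Y : set S) : Prop :=
  f @` setT = Y /\
  forall x, exists (U : set Q) (V : set S) (h : S -> Q),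
    [/\ open U /\ U x, open V /\ f @` U = Y `&` V,
        {within U, continuous f},
        {within f @` U, continuous h}
      & forall y, U y -> h (f y) = y].

Definition r_discrete (Q : topologicalType) (X : groupoid Q) : Prop :=
  local_homeomorphism_onto (grng X) (gunits X).

Definition compactly_supported (Q : topologicalType) (V : zmodType)
    (f : Q -> V) : Prop :=
  compact (closure [set x | f x != 0]).

(* Nets are indexed by directed preorders [(I, le)].  The sums are over
   fibres of [grng]; as the fibres are discrete and closed and the summands
   compactly supported, they are finite sums. *)
Definition amenable (R : realType) (Q : topologicalType) (X : groupoid Q)
    : Prop :=
  exists (I : Type) (le : I -> I -> Prop) (g : I -> Q -> R),
    [/\ inhabited I,
        (forall i, le i i) /\ (forall i j k, le i j -> le j k -> le i k)
        /\ (forall i j, exists k, le i k /\ le j k),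
        forall i, [/\ continuous (g i), compactly_supported (g i)
                    & forall x, 0 <= g i x],
        (forall i u, gunits X u -> \sum_(x \in gfiber X u) g i x <= 1)
        /\ (forall K : set Q, compact K -> K `<=` gunits X ->
            forall e : R, 0 < e -> exists i0, forall i, le i0 i ->
            forall u, K u -> `|\sum_(x \in gfiber X u) g i x - 1| < e)
      & forall K : set Q, compact K ->
        forall e : R, 0 < e -> exists i0, forall i, le i0 i ->
        forall x, K x ->
          \sum_(y \in gfiber X (grng X x))
             `|g i (gmul X (ginv X x) y) - g i y| < e].

Definition groupoid_hom (Q : Type) (X : groupoid Q) (G : groupType)
    (c : Q -> G) : Prop :=
  forall x y, gsrc X x = grng X y -> c (gmul X x y) = (c x * c y)%g.

Section SkewProduct.
Variables (Q : topologicalType) (X : groupoid Q) (G : groupType).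
Variables (c : Q -> discrete_topology G) (cM : groupoid_hom X (c : Q -> G)).

Local Notation QG := (Q * discrete_topology G)%type.

Let cc : Q -> G := c.

Definition skew_mul (p q : QG) : QG := (gmul X p.1 q.1, q.2).
Definition skew_inv (p : QG) : QG := (ginv X p.1, (cc p.1 * (p.2 : G))%g).
(* [p p^-1] and [p^-1 p] for the two operations above; thus
   [(x, t)] and [(y, s)] are composable iff [x] and [y] are and [t = c(y) s]. *)
Definition skew_rng (p : QG) : QG := (grng X p.1, (cc p.1 * (p.2 : G))%g).
Definition skew_src (p : QG) : QG := (gsrc X p.1, p.2).

Let c_rng x : cc (grng X x) = 1%g.
Proof.
have h : gsrc X (grng X x) = grng X (grng X x) by rewrite gsrc_rng grng_rng.
have := cM h; rewrite -{1}(grng_rng X x) gmul_rng => /esym e.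
by apply: (mulgI (cc (grng X x))); rewrite mulg1.
Qed.

Let c_src x : cc (gsrc X x) = 1%g.
Proof. by rewrite -(grng_src X) c_rng. Qed.

Let c_inv x : (cc (ginv X x) * cc x)%g = 1%g.
Proof. by rewrite /cc -cM ?gsrcV// gmulVx; exact: c_src. Qed.

Definition skew_product : groupoid QG.
Proof.
apply: (@Groupoid QG skew_rng skew_src skew_mul skew_inv).
- by move=> [x s]; rewrite /skew_rng/= grng_rng c_rng mul1g.
- by move=> [x s]; rewrite /skew_rng/skew_src/= gsrc_rng.
- by move=> [x s]; rewrite /skew_rng/skew_src/= grng_src c_src mul1g.
- by move=> [x s]; rewrite /skew_src/= gsrc_src.
- move=> [x s] [y t] [xy st]; rewrite /skew_rng/skew_mul/= grngM//.
  by congr pair; rewrite /cc cM// st mulgA.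
- by move=> [x s] [y t] [xy st]; rewrite /skew_src/skew_mul/= gsrcM.
- move=> [x s] [y t] [z u] [xy st] [yz tu].
  by rewrite /skew_mul/= gmulA.
- by move=> [x s]; rewrite /skew_mul/= gmul_rng.
- by move=> [x s]; rewrite /skew_mul/= gmul_src.
- move=> [x s]; rewrite /skew_rng/skew_src/skew_inv/= grngV.
  by rewrite mulgA c_inv mul1g.
- by move=> [x s]; rewrite /skew_rng/skew_src/skew_inv/= gsrcV.
- by move=> [x s]; rewrite /skew_mul/skew_inv/skew_rng/= gmulV.
- by move=> [x s]; rewrite /skew_mul/skew_inv/skew_src/= gmulVx.
Defined.

End SkewProduct.

(* Not necessarily unital; the zero algebra is allowed. *)
HB.mixin Record isCStarAlgebra (R : realType) A
    & CompleteNormedModule R[i] A := {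
  cmul : A -> A -> A;
  cstar : A -> A;
  cmulA : forall x y z : A, cmul x (cmul y z) = cmul (cmul x y) z;
  cmulDl : forall x y z : A, cmul (x + y) z = cmul x z + cmul y z;
  cmulDr : forall x y z : A, cmul x (y + z) = cmul x y + cmul x z;
  cmulZl : forall (a : R[i]) (x y : A), cmul (a *: x) y = a *: cmul x y;
  cmulZr : forall (a : R[i]) (x y : A), cmul x (a *: y) = a *: cmul x y;
  cstarK : forall x : A, cstar (cstar x) = x;
  cstarD : forall x y : A, cstar (x + y) = cstar x + cstar y;
  cstarZ : forall (a : R[i]) (x : A), cstar (a *: x) = a^*%C *: cstar x;
  cstarM : forall x y : A, cstar (cmul x y) = cmul (cstar y) (cstar x);
  norm_cmul : forall x y : A, `|cmul x y| <= `|x| * `|y|;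
  norm_cstar_mul : forall x : A, `|cmul (cstar x) x| = `|x| ^+ 2
}.

#[short(type="cstarAlgType")]
HB.structure Definition CStarAlgebra (R : realType) :=
  {A of isCStarAlgebra R A & CompleteNormedModule R[i] A}.

(* The operations of a *-algebra whose elements form a subset [sa_dom] of an
   ambient vector space (typically a space of functions). *)
Record star_algebra (R : realType) := StarAlgebra {
  sa_space : lmodType R[i];
  sa_dom : set sa_space;
  sa_mul : sa_space -> sa_space -> sa_space;
  sa_star : sa_space -> sa_space
}.

Definition cstar_star_algebra (R : realType) (A : cstarAlgType R) :=
  @StarAlgebra R A setT cmul cstar.

Definition star_hom (R : realType) (S : star_algebra R) (D : cstarAlgType R)
    (phi : sa_space S -> D) : Prop :=
  [/\ forall (a : R[i]) x y, sa_dom x -> sa_dom y ->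
        phi (a *: x + y) = a *: phi x + phi y,
      forall x y, sa_dom x -> sa_dom y ->
        phi (sa_mul x y) = cmul (phi x) (phi y)
    & forall x, sa_dom x -> phi (sa_star x) = cstar (phi x)].

Definition cstar_hom (R : realType) (A D : cstarAlgType R) (phi : A -> D) :=
  star_hom (S := cstar_star_algebra A) phi.

Definition cstar_isomorphic (R : realType) (A D : cstarAlgType R) : Prop :=
  exists phi : A -> D, cstar_hom phi /\ bijective phi.

(* [(E, iota)] is the Hausdorff completion of [S] for the seminorm
   sup { |phi x| : phi a *-homomorphism of S into a C*-algebra };
   as [iota] is one of the phi's, the supremum at [x] is [`|iota x|] iff the
   last clause holds. *)
Definition is_enveloping (R : realType) (S : star_algebra R)
    (E : cstarAlgType R) (iota : sa_space S -> E) : Prop :=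
  [/\ star_hom iota,
      dense (iota @` @sa_dom R S)
    & forall (D : cstarAlgType R) (phi : sa_space S -> D), star_hom phi ->
        forall x, sa_dom x -> `|phi x| <= `|iota x|].

Definition groupoid_star_algebra (R : realType) (Q : topologicalType)
    (X : groupoid Q) : star_algebra R :=
  @StarAlgebra R (Q -> R[i]^o)
    [set f : Q -> R[i]^o | continuous f /\ compactly_supported f]
    (fun f g x => \sum_(y \in gfiber X (grng X x))
                     f y * g (gmul X (ginv X y) x))
    (fun f x => (f (ginv X x))^*%C).

Definition is_groupoid_cstar (R : realType) (Q : topologicalType)
    (X : groupoid Q) (E : cstarAlgType R) (iota : (Q -> R[i]^o) -> E) : Prop :=
  is_enveloping (S := groupoid_star_algebra R X) iota.

Definition cstar_action (R : realType) (G : groupType) (A : cstarAlgType R)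
    (beta : G -> A -> A) : Prop :=
  [/\ forall s, cstar_hom (beta s),
      forall a, beta 1%g a = a
    & forall s t a, beta (s * t)%g a = beta s (beta t a)].

(* C_c(G, A), the finitely supported functions with the convolution and
   involution twisted by the action. *)
Definition crossed_star_algebra (R : realType) (G : groupType)
    (A : cstarAlgType R) (beta : G -> A -> A) : star_algebra R :=
  @StarAlgebra R (G -> A)
    [set f : G -> A | finite_set [set s | f s != 0]]
    (fun f g s => \sum_(t \in [set: G])
                     cmul (f t) (beta t (g (t^-1 * s)%g)))
    (fun f s => beta s (cstar (f s^-1%g))).

Definition is_crossed_product (R : realType) (G : groupType)
    (A : cstarAlgType R) (beta : G -> A -> A)
    (P : cstarAlgType R) (iota : (G -> A) -> P) : Prop :=
  is_enveloping (S := crossed_star_algebra beta) iota.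

Lemma normc_ge0 (R : realType) (z : R[i]) : 0 <= normc z.
Proof. by case: z => a b; exact: sqrtr_ge0. Qed.

Section SquareSum.
Variables (R : realType) (G : choiceType).
Implicit Types x y : G -> R[i]^o.

Definition sqsum x : \bar R := (\esum_(s in [set: G]) (normc (x s) ^+ 2)%:E)%E.

Lemma sqsum_ge0 x : (0 <= sqsum x)%E.
Proof. by apply: esum_ge0 => s _; rewrite lee_fin sqr_ge0. Qed.

Let esumZ_le (r : R) (a : G -> R) : 0 <= r -> (forall s, 0 <= a s) ->
  ((\esum_(s in [set: G]) (r * a s)%:E) <=
     r%:E * (\esum_(s in [set: G]) (a s)%:E))%E.
Proof.
move=> r0 a0; apply: ge_ereal_sup => _ [F [finF _]] <-.
under eq_fsbigr do rewrite EFinM.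
rewrite -ge0_mule_fsumr//.
by apply: lee_wpmul2l => //; apply: ereal_sup_ubound; exists F.
Qed.

Lemma sqsumZ_le (k : R[i]) x : (sqsum (k *: x)%R <= (normc k ^+ 2)%:E * sqsum x)%E.
Proof.
rewrite /sqsum; under eq_esum do rewrite /= Normc.normcM exprMn.
by apply: esumZ_le => *; exact: sqr_ge0.
Qed.

Lemma sqsumD_le (a : R) x y : 0 < a ->
  (sqsum (x + y)%R <= (1 + a)%R%:E * sqsum x + (1 + a^-1)%R%:E * sqsum y)%E.
Proof.
move=> a0; have a1 : 0 <= 1 + a by rewrite addr_ge0// ltW.
have a2 : 0 <= 1 + a^-1 by rewrite addr_ge0// invr_ge0 ltW.
apply: (@le_trans _ _ (\esum_(s in [set: G])
  (((1 + a) * normc (x s) ^+ 2)%R%:E + ((1 + a^-1) * normc (y s) ^+ 2)%R%:E))%E).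
  apply: le_esum => s _; rewrite -EFinD lee_fin.
  apply: (@le_trans _ _ ((normc (x s) + normc (y s)) ^+ 2)).
    by rewrite ler_pXn2r ?nnegrE ?addr_ge0 ?normc_ge0 ?le_normcD.
  set u := normc (x s); set v := normc (y s).
  have -> : (1 + a) * u ^+ 2 + (1 + a^-1) * v ^+ 2 =
            (u + v) ^+ 2 + a^-1 * (a * u - v) ^+ 2.
    by field; rewrite gt_eqF.
  by rewrite lerDl mulr_ge0 ?sqr_ge0// invr_ge0 ltW.
rewrite esumD; last 2 first.
- by move=> s _; rewrite lee_fin mulr_ge0// sqr_ge0.
- by move=> s _; rewrite lee_fin mulr_ge0// sqr_ge0.
by apply: leeD; apply: esumZ_le => // s; exact: sqr_ge0.
Qed.

Definition ell2_pred : {pred G -> R[i]^o} := [pred x | (sqsum x < +oo)%E].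

Let ell2_submod : submod_closed ell2_pred.
Proof.
split.
  rewrite inE/= /sqsum esum1 ?ltry// => s _.
  by rewrite Normc.normc0 expr0n.
move=> k x y; rewrite !inE/= => x2 y2.
apply: (le_lt_trans (sqsumD_le _ _ ltr01)).
rewrite lte_add_pinfty// lte_mul_pinfty ?lee_fin ?sqsum_ge0//.
apply: (le_lt_trans (sqsumZ_le _ _)).
by rewrite lte_mul_pinfty ?lee_fin ?sqr_ge0.
Qed.

HB.instance Definition _ :=
  GRing.isSubmodClosed.Build R[i] (G -> R[i]^o) ell2_pred ell2_submod.

End SquareSum.

Record ell2 (R : realType) (G : choiceType) := Ell2 {
  ell2_fun :> G -> R[i]^o;
  ell2_fun_subproof : ell2_fun \in @ell2_pred R G
}.

Section Ell2.
Variables (R : realType) (G : choiceType).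

HB.instance Definition _ := [isSub for @ell2_fun R G].
HB.instance Definition _ := [Choice of ell2 R G by <:].
HB.instance Definition _ := [SubChoice_isSubLmodule of ell2 R G by <:].

Definition ell2_norm (x : ell2 R G) : R := Num.sqrt (fine (sqsum x)).

Let sqnormE (x : ell2 R G) : (ell2_norm x ^+ 2)%:E = sqsum x.
Proof.
have x2 : (sqsum x < +oo)%E by have := ell2_fun_subproof x; rewrite inE.
rewrite /ell2_norm sqr_sqrtr ?fine_ge0 ?sqsum_ge0// fineK//.
by rewrite ge0_fin_numE ?sqsum_ge0.
Qed.

Let norm_ge0 (x : ell2 R G) : 0 <= ell2_norm x.
Proof. exact: sqrtr_ge0. Qed.

Let norm_eq0 (x : ell2 R G) : ell2_norm x = 0 -> x = 0.
Proof.
move=> x0; apply/val_inj/funext => s /=; apply: Normc.eq0_normc.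
apply/eqP; rewrite -sqrf_eq0 eq_le sqr_ge0 andbT -lee_fin.
apply: (@le_trans _ _ (sqsum x)); last by rewrite -sqnormE x0 expr0n.
apply: esum_ge; exists [set s]; first by split => //; exact: finite_set1.
by rewrite fsbig_set1.
Qed.

Let norm0 : ell2_norm 0 = 0.
Proof.
rewrite /ell2_norm /sqsum esum1/= ?sqrtr0// => s _.
by rewrite !expr0n addr0 sqrtr0 expr0n.
Qed.

Let normZ_le (k : R[i]) x : ell2_norm (k *: x) <= normc k * ell2_norm x.
Proof.
rewrite -(@ler_pXn2r _ 2) ?nnegrE ?mulr_ge0 ?normc_ge0//.
by rewrite exprMn -lee_fin sqnormE [leRHS]EFinM sqnormE; exact: sqsumZ_le.
Qed.

Let normZ (k : R[i]) x : ell2_norm (k *: x) = normc k * ell2_norm x.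
Proof.
have [->|k0] := eqVneq k 0; first by rewrite scale0r norm0 Normc.normc0 mul0r.
apply/eqP; rewrite eq_le normZ_le/=.
have := normZ_le k^-1 (k *: x); rewrite scalerA mulVf// scale1r Normc.normcV.
rewrite mulrC ler_pdivlMr; first by rewrite mulrC.
rewrite lt_neqAle normc_ge0 andbT eq_sym.
by apply: contra_neq k0 => /Normc.eq0_normc.
Qed.

Let normD (x y : ell2 R G) : ell2_norm (x + y) <= ell2_norm x + ell2_norm y.
Proof.
have [/norm_eq0 ->|x0] := eqVneq (ell2_norm x) 0; first by rewrite add0r norm0 add0r.
have [/norm_eq0 ->|y0] := eqVneq (ell2_norm y) 0; first by rewrite addr0 norm0 addr0.
have xp : 0 < ell2_norm x by rewrite lt_neqAle eq_sym x0 norm_ge0.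
have yp : 0 < ell2_norm y by rewrite lt_neqAle eq_sym y0 norm_ge0.
rewrite -(@ler_pXn2r _ 2) ?nnegrE ?addr_ge0// -lee_fin sqnormE.
have := sqsumD_le x y (divr_gt0 yp xp); move=> /le_trans; apply.
rewrite -!sqnormE -!EFinM -EFinD lee_fin le_eqVlt; apply/orP; left; apply/eqP.
by field; rewrite x0 y0.
Qed.

Let cnorm (x : ell2 R G) : R[i] := (ell2_norm x)%:C.

Let cnormD (x y : ell2 R G) : cnorm (x + y) <= cnorm x + cnorm y.
Proof. by rewrite /cnorm -rmorphD/= lecR normD. Qed.

Let cnormZ (k : R[i]) x : cnorm (k *: x) = `|k| * cnorm x.
Proof.
have -> : `|k| = (normc k)%:C by case: k => a b; rewrite normc_def.
by rewrite /cnorm normZ rmorphM.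
Qed.

Let cnorm_eq0 x : cnorm x = 0 -> x = 0.
Proof. by move=> [] /norm_eq0. Qed.

HB.instance Definition _ :=
  @Lmodule_isNormed.Build R[i] (ell2 R G) cnorm cnormD cnormZ cnorm_eq0.

(* linear in the first variable; the sum is the limit of the finite sums *)
Definition ell2_inner (x y : ell2 R G) : R[i] :=
  summability.sum (fun s => (x s * (y s)^*%C : R[i]^o)).

Definition compact_operator (T : ell2 R G -> ell2 R G) : Prop :=
  linear T /\ precompact (T @` [set x | `|x| <= 1]).

(* [(K, rho)]: a C*-algebra identified through [rho] with the C*-algebra of all
   compact operators on l^2(G), with pointwise linear structure, composition,
   Hilbert space adjoint and operator norm. *)
Definition is_compact_operators (K : cstarAlgType R)
    (rho : K -> ell2 R G -> ell2 R G) : Prop :=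
  [/\ forall T, compact_operator T <-> (exists k, rho k = T),
      forall (a : R[i]) k l x, rho (a *: k + l) x = a *: rho k x + rho l x,
      forall k l x, rho (cmul k l) x = rho k (rho l x),
      forall k x y, ell2_inner (rho k x) y = ell2_inner x (rho (cstar k) y)
    & forall k,
        (forall x, `|rho k x| <= `|k| * `|x|) /\
        (forall M : R[i], 0 <= M -> (forall x, `|rho k x| <= M * `|x|) ->
           `|k| <= M)].

End Ell2.

(* [(T, ten)] is a completion of the algebraic tensor product of [B] and [K]
   in a C*-norm: a bilinear *-homomorphic map [ten] such that
   - the induced map on the algebraic tensor product is injective (any of its
     elements is a sum of b_i (x) k_i with linearly independent k_i);
   - finite sums of elementary tensors are dense.
   C*-norms are automatically cross norms.  When [K] is the algebra of compact
   operators, which is nuclear, there is only one C*-norm, so that [T] is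
   the (minimal = maximal) C*-tensor product. *)
Definition is_cstar_tensor (R : realType) (B K T : cstarAlgType R)
    (ten : B -> K -> T) : Prop :=
  [/\ (forall (a : R[i]) b b' k,
         ten (a *: b + b') k = a *: ten b k + ten b' k) /\
      (forall (a : R[i]) b k k',
         ten b (a *: k + k') = a *: ten b k + ten b k'),
      (forall b b' k k', cmul (ten b k) (ten b' k') =
                         ten (cmul b b') (cmul k k')) /\
      (forall b k, cstar (ten b k) = ten (cstar b) (cstar k)),
      forall b k, `|ten b k| = `|b| * `|k|,
      forall n (b : 'I_n -> B) (k : 'I_n -> K),
        (forall a : 'I_n -> R[i], \sum_i a i *: k i = 0 -> forall i, a i = 0) ->
        \sum_i ten (b i) (k i) = 0 -> forall i, b i = 0
    & dense [set t | exists n (b : 'I_n -> B) (k : 'I_n -> K),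
                       t = \sum_i ten (b i) (k i)]].

(* Main.v *)
(* Write C_c(Q x_c G) as "matrices": a function on Q supported on c = g gives,
   for each p in G, a function on the arrows (x, t) with c(x) t = p, to be
   thought of as the matrix entry f (x) e_{p, g^-1 p}.  Under this
   identification the translations beta_s become conjugation by permutation
   matrices, so that C_c(Q x_c G) x G and the finite matrices over C_c(Q) have
   a common system of generators.

   One direction: f (x) e_{p, g^-1 p} u_s |-> f (x) e_{p, g^-1 p s} is a covariant
   family of maps into C^*(Q) (x) K; its members are bounded by the enveloping
   norm because x and x u_s have the same x x^*, so no multiplier algebra is
   needed.  Universality of the crossed product gives Phi.

   Other direction: the corners f |-> f (x) e_{p,q} of C_c(Q) inside the crossed
   product extend to C^*(Q) by universality of C^*(Q).  On n x n matrices the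
   resulting *-homomorphism is bounded by n^2 times the norm of the tensor
   product; applying the bound to (x^* x)^(2^k) removes the constant, hence an
   inverse of Phi.

   That C_c(Q x_c G) generates the crossed product requires *-homomorphisms
   between C*-algebras to be contractive; this is proved without spectral
   theory by writing a self-adjoint strict contraction as the real part of a
   unitary. *)
Require Import Defs.
From mathcomp Require Import all_boot all_order all_algebra.
From mathcomp Require Import finmap.
From mathcomp Require Import all_classical all_reals all_analysis.
From mathcomp Require Import complex ring lra.
From mathcomp Require summability.

Set Implicit Arguments.
Unset Strict Implicit.
Unset Printing Implicit Defensive.

Import Order.TTheory GRing.Theory Num.Theory.
Import numFieldNormedType.Exports.

Local Open Scope classical_set_scope.
Local Open Scope ring_scope.
Local Open Scope complex_scope.

Local Notation normc := Normc.normc.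

(** * Norms and bounded linear maps *)

(** The groupoid algebras and the crossed product are known only through a dense image and a
    maximality property of the norm. So every map is prescribed on generators, bounded there and
    extended, and identities spread by density, one variable at a time.

    The row and column of a generator are read off an arrow [(x, t)] of the skew product: with
    [c(x) = g], its range has second coordinate [p = c(x) t] and its source has [t = g^-1 p]. As [c]
    is locally constant, a compactly supported function has only finitely many nonzero pieces with
    fixed [(p, g)].

    Two obstacles shape the rest. The tensor product comes with no universal property for matrices
    over [C^*(Q)], so the inverse of [Phi] needs an a priori estimate; its source is the cross norm,
    which controls single matrix entries. And [C^*(Q)] may lack a unit, so an entry [b] cannot be
    cut out by diagonal matrix units; multiplying by copies of [b^*] on both sides replaces them. *)

Section RealNorm.
Variables (R : realType) (V : normedModType R[i]).
Implicit Types x y z : V.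

(** Norms of modules over [R[i]] take values in [R[i]]; their real parts live in a totally ordered
    field, where linear arithmetic applies. *)
Definition nrm x : R := complex.Re `|x|.

Lemma nrmE x : `|x| = (nrm x)%:C.
Proof. by rewrite /nrm RRe_real. Qed.

Lemma nrm_ge0 x : 0 <= nrm x.
Proof. by rewrite -ler0c -nrmE. Qed.

Lemma nrm0 : nrm 0 = 0.
Proof. by rewrite /nrm normr0. Qed.

Lemma nrm0_eq0 x : nrm x = 0 -> x = 0.
Proof. by move=> x0; apply/normr0_eq0; rewrite nrmE x0. Qed.

Lemma nrmN x : nrm (- x) = nrm x.
Proof. by rewrite /nrm normrN. Qed.

Lemma nrmD x y : nrm (x + y) <= nrm x + nrm y.
Proof. by rewrite -lecR rmorphD/= -!nrmE ler_normD. Qed.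

Lemma nrmB x y : nrm (x - y) <= nrm x + nrm y.
Proof. by rewrite (le_trans (nrmD _ _))// nrmN. Qed.

Lemma nrm_distrC x y : nrm (x - y) = nrm (y - x).
Proof. by rewrite -nrmN opprB. Qed.

Lemma nrm_distD y x z : nrm (x - z) <= nrm (x - y) + nrm (y - z).
Proof. by rewrite (le_trans _ (nrmD _ _))// addrA subrK. Qed.

Lemma nrmZ (a : R[i]) x : nrm (a *: x) = normc a * nrm x.
Proof.
apply: complexI; rewrite rmorphM/= -!nrmE normrZ; congr (_ * _).
Qed.

Lemma nrm_sum (I : Type) (r : seq I) (F : I -> V) :
  nrm (\sum_(i <- r) F i) <= \sum_(i <- r) nrm (F i).
Proof.
elim: r => [|i r ih]; first by rewrite !big_nil nrm0.
by rewrite !big_cons (le_trans (nrmD _ _))// lerD2l.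
Qed.

Lemma nrm_eqP x y : (forall e : R, 0 < e -> nrm (x - y) <= e) -> x = y.
Proof.
move=> xy; apply/eqP; rewrite -subr_eq0; apply/eqP/nrm0_eq0/eqP.
by rewrite eq_le nrm_ge0 andbT; apply/ler_addgt0Pl => e /xy; rewrite addr0.
Qed.

Lemma nrm_ballE x (e : R) : ball x e%:C = [set y | nrm (x - y) < e].
Proof.
rewrite -ball_normE; apply/seteqP; split => y; rewrite /ball_/= nrmE ltcR//.
Qed.

Lemma dense_nrm (S : set V) x (e : R) : dense S -> 0 < e ->
  exists2 s, S s & nrm (x - s) < e.
Proof.
move=> dS e0.
have e0' : 0 < e%:C :> R[i] by rewrite ltcR.
have [|y [xy Sy]] := dS _ _ (open_interior (ball x e%:C)).
  by exists x; apply: nbhsx_ballx.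
exists y => //.
by have /= := interior_subset xy; rewrite nrm_ballE.
Qed.

End RealNorm.

Lemma complete_nrm (R : realType) (V : completeNormedModType R[i]) (u : nat -> V) :
  (forall e : R, 0 < e -> exists N, forall m n, (N <= m)%N -> (N <= n)%N ->
     nrm (u m - u n) < e) ->
  exists l, forall e : R, 0 < e -> exists N, forall n, (N <= n)%N ->
     nrm (u n - l) < e.
Proof.
move=> uC.
have : cauchy (u @ \oo).
  apply/cauchyP => e e0.
  have er : e = (complex.Re e)%:C by rewrite RRe_real// gtr0_real.
  have [|N uN] := uC (complex.Re e); first by rewrite -ltcR -er.
  exists (u N); rewrite er nrm_ballE; exists N => // n /= Nn.
  exact: uN.
move=> /cauchy_cvgP/cvg_ex[l ul]; exists l => e e0.
have : nbhs l (ball l e%:C) by apply: nbhsx_ballx; rewrite ltcR.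
move=> /ul [N _ uN]; exists N => n Nn.
by have := uN n Nn; rewrite /= nrm_ballE /= nrm_distrC.
Qed.

Section Extension.
Variables (R : realType) (E D : completeNormedModType R[i]).

Definition contractive (f : E -> D) := forall x, nrm (f x) <= nrm x.

Definition bounded_linear (f : E -> D) :=
  linear f /\ exists2 M : R, 0 <= M & forall x, nrm (f x) <= M * nrm x.

Lemma contractive_bounded f : linear f -> contractive f -> bounded_linear f.
Proof. by move=> fl fc; split => //; exists 1 => // x; rewrite mul1r. Qed.

Lemma linear_sub (f : E -> D) x y : linear f -> f (x - y) = f x - f y.
Proof. by move=> fl; rewrite addrC -scaleN1r fl scaleN1r addrC. Qed.

Lemma eq_on_dense (f g : E -> D) (W : set E) :
  bounded_linear f -> bounded_linear g ->
  (forall x (e : R), 0 < e -> exists2 s, W s & nrm (x - s) < e) ->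
  (forall w, W w -> f w = g w) -> f =1 g.
Proof.
move=> [fl [M M0 fM]] [gl [N N0 gN]] dW fg x; apply: nrm_eqP => e e0.
have MN : 0 < M + N + 1 by lra.
have [s Ws xs] := dW x _ (divr_gt0 e0 MN).
rewrite (le_trans (nrm_distD (f s) _ _))// {2}(fg s)//.
rewrite -!linear_sub// (le_trans (lerD (fM _) (gN _)))//.
rewrite (nrm_distrC s) -mulrDl.
move: xs; rewrite ltr_pdivlMr// => xs.
have := nrm_ge0 (x - s); lra.
Qed.

(** [Z] is the graph of a densely defined linear contraction. Stated for a relation, the lemma needs
    no separate proof of well-definedness: linearity and the norm bound give
    [nrm (y - y') <= nrm (x - x')], so equal arguments have equal values. *)
Lemma dense_extension (Z : E -> D -> Prop) :
  (forall (a : R[i]) x x' y y', Z x y -> Z x' y' ->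
     Z (a *: x + x') (a *: y + y')) ->
  (forall x y, Z x y -> nrm y <= nrm x) ->
  (forall x (e : R), 0 < e -> exists2 s, (exists y, Z s y) & nrm (x - s) < e) ->
  exists f : E -> D,
    [/\ linear f, contractive f & forall x y, Z x y -> f x = y].
Proof.
move=> Zl Zc Zd.
have ZB x x' y y' : Z x y -> Z x' y' -> nrm (y - y') <= nrm (x - x').
  move=> xy xy'; apply: Zc.
  have := Zl (-1) _ _ _ _ xy' xy; rewrite !scaleN1r.
  by rewrite ![- _ + _]addrC.
have lim x : exists l, forall e : R, 0 < e -> exists s y,
    [/\ Z s y, nrm (x - s) < e & nrm (y - l) < e].
  have /choice[u uP] : forall n : nat, exists p : E * D,
      Z p.1 p.2 /\ nrm (x - p.1) < n.+1%:R^-1.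
    move=> n; have [|s [y sy] xs] := Zd x (n.+1%:R^-1) _; first by rewrite invr_gt0.
    by exists (s, y).
  have small (e : R) : 0 < e -> exists N, forall n, (N <= n)%N ->
      nrm (x - (u n).1) < e.
    move=> e0; exists (Num.truncn e^-1) => n Nn.
    apply: (lt_trans (uP n).2).
    rewrite invf_plt ?posrE//.
    rewrite (lt_le_trans (truncnS_gt _))//.
    by rewrite ler_nat.
  have [l ul] : exists l, forall e : R, 0 < e -> exists N, forall n, (N <= n)%N ->
     nrm ((u n).2 - l) < e.
    apply: complete_nrm => e e0.
    have e2 : 0 < e / 2 by rewrite divr_gt0.
    have [N uN] := small _ e2; exists N => m n Nm Nn.
    rewrite (le_lt_trans (ZB _ _ _ _ (uP m).1 (uP n).1))//.
    rewrite (le_lt_trans (nrm_distD x _ _))// (nrm_distrC _ x).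
    by have := uN _ Nm; have := uN _ Nn; lra.
  exists l => e e0; have [N uN] := small _ e0; have [M uM] := ul _ e0.
  exists (u (maxn N M)).1, (u (maxn N M)).2; split; first exact: (uP _).1.
    by apply: uN; rewrite leq_maxl.
  by apply: uM; rewrite leq_maxr.
have /choice[f fP] := lim.
have fZ x y : Z x y -> f x = y.
  move=> xy; apply: nrm_eqP => e e0.
  have e2 : 0 < e / 2 by rewrite divr_gt0.
  have [s [t [st xs ty]]] := fP x _ e2.
  rewrite (le_trans (nrm_distD t _ _))// (nrm_distrC (f x)).
  by have := ZB _ _ _ _ st xy; rewrite (nrm_distrC s); lra.
exists f; split => //.
- move=> a x x'; apply: nrm_eqP => e e0.
  (* With [d = e / (2 * c)], the six approximation errors below total at most [(4 + 2 |a|) d], which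
     is at most [2 * c * d = e]. *)
  set c := 1 + 1 + (normc a + normc a).
  have c0 : 0 < c by rewrite /c; have := normc_ge0 a; lra.
  have e2 : 0 < e / (2 * c) by rewrite divr_gt0// mulr_gt0.
  have [s [y [sy xs yf]]] := fP x _ e2.
  have [s' [y' [sy' xs' yf']]] := fP x' _ e2.
  have [t [z [tz xt zf]]] := fP (a *: x + x') _ e2.
  have k1 := ZB _ _ _ _ tz (Zl a _ _ _ _ sy sy').
  have k2 : nrm (t - (a *: s + s')) <=
      nrm (a *: x + x' - t) + (normc a * nrm (x - s) + nrm (x' - s')).
    rewrite (le_trans (nrm_distD (a *: x + x') _ _))// (nrm_distrC t) lerD2l.
    rewrite opprD addrACA -scalerBr (le_trans (nrmD _ _))//.
    by rewrite nrmZ.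
  have k3 : nrm (a *: y + y' - (a *: f x + f x')) <=
      normc a * nrm (y - f x) + nrm (y' - f x').
    by rewrite opprD addrACA -scalerBr (le_trans (nrmD _ _))// nrmZ.
  have a0 := normc_ge0 a.
  rewrite (le_trans (nrm_distD z _ _))// (nrm_distrC _ z).
  rewrite (le_trans (lerD (lexx _) (nrm_distD (a *: y + y') _ _)))//.
  have l1 := ler_wpM2l a0 (ltW xs).
  have l2 := ler_wpM2l a0 (ltW yf).
  have : (e / (2 * c)) * (2 * c) = e by rewrite divfK// mulf_neq0// gt_eqF.
  have l3 := mulr_ge0 a0 (ltW e2).
  set d := e / (2 * c) in xs yf xs' yf' xt zf l1 l2 l3 *.
  by rewrite /c; lra.
- move=> x; apply/ler_addgt0Pl => e e0.
  have e2 : 0 < e / 2 by rewrite divr_gt0.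
  have [s [y [sy xs yf]]] := fP x _ e2.
  have := Zc _ _ sy.
  have := nrmD (f x - y) y; rewrite subrK (nrm_distrC (f x)).
  have := nrmD (s - x) x; rewrite subrK (nrm_distrC s).
  lra.
Qed.

End Extension.

Section BoundedLinear.
Variable R : realType.
Implicit Types E D : completeNormedModType R[i].

Lemma bounded_linear_id E : bounded_linear (@id E).
Proof. by apply: contractive_bounded => // x. Qed.

Lemma bounded_linear0 E D : bounded_linear (fun _ : E => 0 : D).
Proof.
split; first by move=> a x y; rewrite scaler0 addr0.
by exists 0 => // x; rewrite nrm0 mul0r.
Qed.

Lemma bounded_linear_comp E D (L : completeNormedModType R[i]) (g : D -> L) (f : E -> D) :
  bounded_linear g -> bounded_linear f -> bounded_linear (g \o f).
Proof.
move=> [gl [M M0 gM]] [fl [N N0 fN]]; split.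
  by move=> a x y /=; rewrite fl gl.
exists (M * N); first exact: mulr_ge0.
by move=> x /=; rewrite (le_trans (gM _))// -mulrA ler_wpM2l.
Qed.

End BoundedLinear.

(** * C*-algebras *)

Section CStar.
Variable (R : realType).
Implicit Types A D : cstarAlgType R.

Section OneAlgebra.
Variable A : cstarAlgType R.
Implicit Types x y z : A.

Lemma cmul0l y : cmul 0 y = 0 :> A.
Proof. by rewrite -[X in cmul X](scale0r (0 : A)) cmulZl scale0r. Qed.

Lemma cmul0r y : cmul y 0 = 0 :> A.
Proof. by rewrite -[X in cmul _ X](scale0r (0 : A)) cmulZr scale0r. Qed.

Lemma cstar0 : cstar 0 = 0 :> A.
Proof. by rewrite -[X in cstar X](scale0r (0 : A)) cstarZ conjc0 scale0r. Qed.

Lemma cmulNl x y : cmul (- x) y = - cmul x y.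
Proof. by rewrite -scaleN1r cmulZl scaleN1r. Qed.

Lemma cmulNr x y : cmul x (- y) = - cmul x y.
Proof. by rewrite -scaleN1r cmulZr scaleN1r. Qed.

Lemma cstarN x : cstar (- x) = - cstar x.
Proof. by rewrite -scaleN1r cstarZ rmorphN rmorph1 scaleN1r. Qed.

Lemma cmulBl x y z : cmul (x - y) z = cmul x z - cmul y z.
Proof. by rewrite cmulDl cmulNl. Qed.

Lemma cmulBr x y z : cmul z (x - y) = cmul z x - cmul z y.
Proof. by rewrite cmulDr cmulNr. Qed.

Lemma cstarB x y : cstar (x - y) = cstar x - cstar y.
Proof. by rewrite cstarD cstarN. Qed.

Lemma cmul_suml I (r : seq I) (Pr : pred I) (F : I -> A) y :
  cmul (\sum_(i <- r | Pr i) F i) y = \sum_(i <- r | Pr i) cmul (F i) y.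
Proof. by apply: (big_morph (fun x => cmul x y)) => [u v|]; rewrite ?cmulDl ?cmul0l. Qed.

Lemma cmul_sumr I (r : seq I) (Pr : pred I) (F : I -> A) y :
  cmul y (\sum_(i <- r | Pr i) F i) = \sum_(i <- r | Pr i) cmul y (F i).
Proof. by apply: (big_morph (fun x => cmul y x)) => [u v|]; rewrite ?cmulDr ?cmul0r. Qed.

Lemma cstar_sum I (r : seq I) (Pr : pred I) (F : I -> A) :
  cstar (\sum_(i <- r | Pr i) F i) = \sum_(i <- r | Pr i) cstar (F i).
Proof. by apply: (big_morph (@cstar R A)) => [u v|]; rewrite ?cstarD ?cstar0. Qed.

Lemma nrm_mul x y : nrm (cmul x y) <= nrm x * nrm y.
Proof. by rewrite -lecR rmorphM/= -!nrmE norm_cmul. Qed.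

Lemma nrm_star_mul x : nrm (cmul (cstar x) x) = nrm x ^+ 2.
Proof. by apply: complexI; rewrite rmorphXn/= -!nrmE norm_cstar_mul. Qed.

Lemma nrm_star x : nrm (cstar x) = nrm x.
Proof.
have le y : nrm y <= nrm (cstar y).
  have [->|y0] := eqVneq (nrm y) 0; first exact: nrm_ge0.
  have yp : 0 < nrm y by rewrite lt_neqAle eq_sym y0 nrm_ge0.
  by rewrite -(ler_pM2r yp) -expr2 -nrm_star_mul nrm_mul.
by apply/eqP; rewrite eq_le le -{2}(cstarK x) le.
Qed.

Lemma nrm_mul_star x : nrm (cmul x (cstar x)) = nrm x ^+ 2.
Proof. by rewrite -{1}(cstarK x) nrm_star_mul nrm_star. Qed.

Lemma bounded_linear_mull y : bounded_linear (cmul y).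
Proof.
split; first by move=> a x z; rewrite cmulDr cmulZr.
by exists (nrm y); [exact: nrm_ge0 | move=> x; exact: nrm_mul].
Qed.

Lemma bounded_linear_mulr y : bounded_linear (fun x => cmul x y).
Proof.
split; first by move=> a x z; rewrite cmulDl cmulZl.
by exists (nrm y); [exact: nrm_ge0 | move=> x; rewrite mulrC; exact: nrm_mul].
Qed.

(* The fixed point of [k |-> (h^2 + k^2) / 2]: formally [1 - k] is a square
   root of [1 - h^2]. *)
Lemma sqrt_one_minus_square h : cstar h = h -> nrm h < 1 ->
  exists k : A, [/\ cstar k = k, cmul h k = cmul k h
              & k + k = cmul h h + cmul k k].
Proof.
move=> hs h1; set rr := nrm h.
pose T x := (2^-1 : R[i]) *: (cmul h h + cmul x x).
pose u n := iter n T 0.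
have n2 : normc (2^-1 : R[i]) = 2^-1.
  by rewrite Normc.normcV; congr _^-1; rewrite normcMn Normc.normc1.
have r0 : 0 <= rr := nrm_ge0 h.
have uS n : cstar (u n) = u n.
  elim: n => [|n ih]; first exact: cstar0.
  rewrite /u/= -/(u n) /T cstarZ cstarD !cstarM hs ih.
  congr (_ *: _); rewrite rmorphV ?unitfE// rmorphMn rmorph1//.
have uC n : cmul h (u n) = cmul (u n) h.
  elim: n => [|n ih]; first by rewrite cmul0l cmul0r.
  rewrite /u/= -/(u n) /T cmulZl cmulZr cmulDl cmulDr; congr (_ *: (_ + _)).
    by rewrite cmulA.
  by rewrite cmulA ih -cmulA ih cmulA.
have un n : nrm (u n) <= rr.
  elim: n => [|n ih]; first by rewrite /u/= nrm0.
  rewrite /u/= -/(u n) /T nrmZ n2.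
  have := nrmD (cmul h h) (cmul (u n) (u n)).
  have := nrm_mul h h; have := nrm_mul (u n) (u n); rewrite -/rr.
  have : nrm (u n) * nrm (u n) <= rr * rr by apply: ler_pM => //; exact: nrm_ge0.
  have : rr * rr <= rr by rewrite ler_piMr// ltW.
  lra.
(* [T] maps the ball of radius [rr < 1] to itself and has Lipschitz constant [rr] there: split
   [x x - y y] as [x (x - y) + (x - y) y], which requires no commutation. *)
have Tc x y : nrm x <= rr -> nrm y <= rr -> nrm (T x - T y) <= rr * nrm (x - y).
  move=> xr yr; rewrite /T -scalerBr nrmZ n2 opprD addrACA subrr add0r.
  have -> : cmul x x - cmul y y = cmul x (x - y) + cmul (x - y) y.
    by rewrite cmulBr cmulBl addrA subrK.
  have := nrmD (cmul x (x - y)) (cmul (x - y) y).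
  have := nrm_mul x (x - y); have := nrm_mul (x - y) y.
  have := ler_wpM2r (nrm_ge0 (x - y)) xr.
  have := ler_wpM2l (nrm_ge0 (x - y)) yr.
  set d := nrm (x - y).
  rewrite (mulrC d rr); lra.
have step m n : nrm (u (n + m)%N - u n) <= rr ^+ n * (rr + rr).
  elim: n => [|n ih].
    rewrite expr0 mul1r add0n (le_trans (nrmB _ _))// lerD//.
  rewrite exprS -mulrA (le_trans _ (ler_wpM2l r0 ih))//.
  exact: Tc.
have [k uk] : exists k, forall e : R, 0 < e -> exists N, forall n, (N <= n)%N ->
     nrm (u n - k) < e.
  apply: complete_nrm => e e0.
  have [N rN] : exists N, rr ^+ N * (rr + rr) < e.
    have : (fun n => rr ^+ n * (rr + rr)) @ \oo --> (0 : R) * (rr + rr).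
      apply: cvgM; last exact: cvg_cst.
      by apply: cvg_expr; rewrite ger0_norm.
    rewrite mul0r => /cvgr0Pnorm_lt /(_ e e0) [N _ NN]; exists N.
    by have := NN N (leqnn N); apply: le_lt_trans; rewrite ler_norm.
  have key m n : (N <= m)%N -> (m <= n)%N -> nrm (u m - u n) < e.
    move=> Nm mn; rewrite nrm_distrC -(subnKC mn).
    rewrite (le_lt_trans (step _ _))// (le_lt_trans _ rN)//.
    apply: ler_wpM2r; first by rewrite addr_ge0.
    by apply: ler_wiXn2l => //; rewrite ltW.
  exists N => m n Nm Nn; have [mn|/ltnW nm] := leqP m n; first exact: key.
  by rewrite nrm_distrC; exact: key.
have kr : nrm k <= rr.
  apply/ler_addgt0Pl => e /uk [N /(_ N (leqnn N))].
  have := nrmD (k - u N) (u N); rewrite subrK nrm_distrC.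
  by have := un N; lra.
have kT : k = T k.
  apply: nrm_eqP => e e0.
  have e2 : 0 < e / 2 by rewrite divr_gt0.
  have [N uN] := uk _ e2.
  rewrite (le_trans (nrm_distD (u N.+1) _ _))// nrm_distrC.
  have /(le_trans (Tc _ _ (un N) kr)) : rr * nrm (u N - k) <= nrm (u N - k).
    by rewrite ler_piMl ?nrm_ge0// ltW.
  have := uN N (leqnn N); have := uN N.+1 (leqnSn N).
  have -> : u N.+1 = T (u N) by [].
  lra.
exists k; split.
- apply: nrm_eqP => e e0.
  have e2 : 0 < e / 2 by rewrite divr_gt0.
  have [N /(_ N (leqnn N)) uN] := uk _ e2.
  rewrite (le_trans (nrm_distD (u N) _ _))// -{1}(uS N) -cstarB nrm_star.
  by rewrite (nrm_distrC k); lra.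
- apply: nrm_eqP => e e0.
  have e2 : 0 < e / 2 by rewrite divr_gt0.
  have [N /(_ N (leqnn N)) uN] := uk _ e2.
  rewrite (le_trans (nrm_distD (cmul h (u N)) _ _))// {2}uC -cmulBl -cmulBr.
  have := nrm_mul h (k - u N); have := nrm_mul (u N - k) h.
  rewrite (nrm_distrC k) -/rr.
  have := ler_wpM2r (nrm_ge0 (u N - k)) (ltW h1); rewrite -/rr mulrC.
  by move: uN; set d := nrm (u N - k); lra.
- rewrite {1 2}kT /T -scalerDl -[RHS]scale1r; congr (_ *: _).
  by field.
Qed.

End OneAlgebra.

Lemma cstar_homP A D (psi : A -> D) : cstar_hom psi ->
  [/\ linear psi, forall x y, psi (cmul x y) = cmul (psi x) (psi y)
    & forall x, psi (cstar x) = cstar (psi x)].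
Proof. case=> l m s; split; first by move=> a x y; exact: (l a x y).
  by move=> x y; exact: (m x y).
by move=> x; exact: (s x). Qed.

Lemma bounded_linear_star A D (f : A -> D) :
  bounded_linear f -> bounded_linear (fun x => cstar (f (cstar x))).
Proof.
move=> [fl [M M0 fM]]; split.
  by move=> a x y; rewrite cstarD cstarZ fl cstarD cstarZ conjcK.
by exists M => // x; rewrite nrm_star (le_trans (fM _))// nrm_star.
Qed.

(* For self-adjoint [h] of norm < 1 the operator [u = h + i sqrt(1 - h^2)] is
   unitary, and so is its image, whence [psi h = (u + u^* ) / 2] contracts. *)
Lemma cstar_hom_contractive A D (psi : A -> D) : cstar_hom psi -> contractive psi.
Proof.
move=> /cstar_homP [pl pm ps].
have pD x y : psi (x + y) = psi x + psi y.
  by have := pl 1 x y; rewrite !scale1r.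
have p0 : psi 0 = 0 by have := pl (-1) 0 0; rewrite scaleN1r oppr0 addr0 scaleN1r addNr.
have pZ a x : psi (a *: x) = a *: psi x by have := pl a x 0; rewrite p0 !addr0.
have unit_ball h : cstar h = h -> nrm h < 1 -> nrm (psi h) <= 1.
  move=> hs h1; have [k [ks hk kk]] := sqrt_one_minus_square hs h1.
  set p := psi h; set q := psi k.
  have p_s : cstar p = p by rewrite /p -ps hs.
  have q_s : cstar q = q by rewrite /q -ps ks.
  have pq : cmul p q = cmul q p by rewrite /p /q -!pm hk.
  have qq : q + q = cmul p p + cmul q q by rewrite /p /q -!pm -!pD kk.
  (* The algebra may have no unit, so the unitary [p + a (1 - q)], with [a] equal to [i] or [-i], is
     used only as an isometry acting by left multiplication. *)
  have uni (a : R[i]) x : a * a = -1 -> a^*%C = - a ->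
      nrm (cmul p x + a *: (x - cmul q x)) = nrm x.
    move=> aa ac.
    apply/eqP; rewrite -(@eqrXn2 _ 2) ?nrm_ge0// -!nrm_star_mul; apply/eqP.
    congr nrm.
    set y := x - cmul q x.
    rewrite cstarD cstarZ cstarM p_s ac cmulDl !cmulDr !cmulZr !cmulZl scalerA.
    rewrite mulrN aa opprK scale1r scaleNr.
    have ys : cstar y = cstar x - cmul (cstar x) q by rewrite /y cstarB cstarM q_s.
    have -> : cmul (cmul (cstar x) p) y = cmul (cstar y) (cmul p x).
      rewrite ys /y cmulBr cmulBl; congr (_ - _).
        by rewrite cmulA.
      by rewrite -!cmulA; congr cmul; rewrite !cmulA pq.
    rewrite addrA -[_ + _ - _]addrA subrr addr0.
    have -> : cmul (cstar y) y =
      cmul (cstar x) x - cmul (cstar x) (cmul (q + q) x) + cmul (cstar x) (cmul (cmul q q) x).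
      rewrite ys /y cmulBr !cmulBl !cmulDl !cmulDr !cmulA.
      by rewrite !opprD !opprK !addrA.
    rewrite qq cmulDl cmulDr opprD !addrA -[_ + _ - _ + _]addrA addNr addr0 -!addrA.
    by rewrite !cmulA addrCA subrr addr0.
  (* Twice [p x] is the sum of the images of [x] under the two isometries. Taking [x = p] afterwards
     gives [|p|^2 = |p^* p| <= |p|]. *)
  have key x : nrm (cmul p x) <= nrm x.
    have two : cmul p x + cmul p x = (cmul p x + 'i *: (x - cmul q x))
             + (cmul p x + (- 'i) *: (x - cmul q x)).
      by rewrite addrACA -scalerDl subrr scale0r addr0.
    have i2 : ('i%C : R[i]) * 'i%C = -1 by rewrite -expr2 sqr_i.
    have e1 := uni 'i%C x i2 _.
    have e2 := uni (- 'i%C) x _ _.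
    have := nrmD (cmul p x + 'i *: (x - cmul q x)) (cmul p x + (- 'i) *: (x - cmul q x)).
    rewrite -two e1 ?e2; first last.
    - by apply/eqP; rewrite eq_complex/= oppr0 !eqxx.
    - by apply/eqP; rewrite eq_complex/= !oppr0 opprK !eqxx.
    - by rewrite mulrNN.
    rewrite -mulr2n -scaler_nat nrmZ normcMn Normc.normc1.
    lra.
  have := key p; rewrite -{1}p_s nrm_star_mul.
  have [->|n0] := eqVneq (nrm p) 0; first by rewrite ler01.
  have np : 0 < nrm p by rewrite lt_neqAle eq_sym n0 nrm_ge0.
  by rewrite -[leRHS]mul1r expr2 ler_pM2r.
have sa h : cstar h = h -> nrm (psi h) <= nrm h.
  move=> hs; apply/ler_addgt0Pl => e e0.
  have d0 : 0 < e + nrm h by have := nrm_ge0 h; lra.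
  set d := e + nrm h in d0 *.
  have nd : normc (d^-1)%:C = d^-1.
    by rewrite /= expr0n addr0 sqrtr_sqr ger0_norm// invr_ge0 ltW.
  have := unit_ball ((d^-1)%:C *: h).
  rewrite cstarZ hs conjc_real pZ !nrmZ nd => /(_ erefl).
  rewrite ![d^-1 * _]mulrC ltr_pdivrMr// ler_pdivrMr// !mul1r; apply.
  by rewrite /d; lra.
move=> x; rewrite -(@ler_pXn2r _ 2) ?nnegrE ?nrm_ge0// -!nrm_star_mul -ps -pm.
by apply: sa; rewrite cstarM cstarK.
Qed.

(* Squaring removes the constant: [|x|^(2^k) <= C |y|^(2^k)] for all [k]. *)
Lemma nrm_le_of_squaring A D (Z : A -> D -> Prop) (C : R) :
  (forall x y, Z x y -> Z (cmul (cstar x) x) (cmul (cstar y) y)) ->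
  (forall x y, Z x y -> nrm x <= C * nrm y) ->
  forall x y, Z x y -> nrm x <= nrm y.
Proof.
move=> Zs ZC x y xy.
have pow k : nrm x ^+ (2 ^ k) <= C * nrm y ^+ (2 ^ k).
  elim: k x y xy => [|k ih] x y xy; first exact: ZC.
  by rewrite expnS !exprM -!nrm_star_mul; exact: ih (Zs _ _ xy).
rewrite leNgt; apply/negP => yx.
have x0 : 0 < nrm x by apply: le_lt_trans yx; exact: nrm_ge0.
have [y0|yn0] := eqVneq (nrm y) 0.
  by have := pow 0; rewrite y0 !expr1 mulr0 leNgt x0.
have y0 : 0 < nrm y by rewrite lt_neqAle eq_sym yn0 nrm_ge0.
have z1 : 1 < nrm x / nrm y by rewrite ltr_pdivlMr// mul1r.
set z := nrm x / nrm y in z1.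
have zC k : z ^+ (2 ^ k) <= C by rewrite expr_div_n ler_pdivrMr ?exprn_gt0.
(* Bernoulli's inequality: the powers of [z > 1] are unbounded, against [zC]. The [N] below makes
   [2 ^ N.+1 * (z - 1)] exceed [C]. *)
have bern n : 1 + n%:R * (z - 1) <= z ^+ n.
  elim: n => [|n ih]; first by rewrite mul0r addr0 expr0.
  have : 0 <= n%:R * (z - 1) * (z - 1) by rewrite !mulr_ge0// subr_ge0 ltW.
  rewrite exprS; have := ler_wpM2l (le_trans ler01 (ltW z1)) ih.
  rewrite -natr1 => ? ?; nra.
have C0 : 0 <= C by apply: le_trans (zC 0); rewrite expr1 ltW// (lt_trans _ z1).
set N := Num.truncn (C / (z - 1)).
have : C / (z - 1) < (2 ^ N.+1)%:R.
  rewrite (lt_le_trans (truncnS_gt _))// ler_nat -/N.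
  by rewrite ltnW// ltn_expl.
rewrite ltr_pdivrMr ?subr_gt0//.
have := bern (2 ^ N.+1)%N; have := zC N.+1; lra.
Qed.

End CStar.

(** * Systems of matrix units *)

Section MatrixUnits.
Variables (R : realType) (G : eqType) (B : cstarAlgType R).

(** [th p q b] plays the role of [b (x) e_{p,q}]: the conditions say that finite matrices over [B]
    act in [D] through a *-homomorphism that is contractive on each entry. *)
Definition matrix_system (D : cstarAlgType R) (th : G -> G -> B -> D) :=
  [/\ forall p q, linear (th p q),
      forall p q r s b b', cmul (th p q b) (th r s b') =
        if q == r then th p s (cmul b b') else 0,
      forall p q b, cstar (th p q b) = th q p (cstar b)
    & forall p q b, nrm (th p q b) <= nrm b].

(** A list of positions and entries is a formal finite matrix that makes sense in every system at
    once; positions may repeat, and [coef] collects them. *)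
Definition matrix_sum (D : cstarAlgType R) (th : G -> G -> B -> D)
  (l : seq (G * G * B)) : D := \sum_(i <- l) th i.1.1 i.1.2 i.2.

Definition coef (l : seq (G * G * B)) (p q : G) : B :=
  \sum_(i <- l | i.1 == (p, q)) i.2.

Section OneSystem.
Variables (D : cstarAlgType R) (th : G -> G -> B -> D).
Hypothesis thS : matrix_system th.

Let thl p q : linear (th p q). Proof. by case: thS. Qed.
Let thM p q r s b b' : cmul (th p q b) (th r s b') =
        if q == r then th p s (cmul b b') else 0.
Proof. by case: thS => _ ->. Qed.
Let thV p q b : cstar (th p q b) = th q p (cstar b).
Proof. by case: thS => _ _ ->. Qed.

Lemma matrix_system0 p q : th p q 0 = 0.
Proof. by have := thl p q (-1) 0 0; rewrite scaler0 addr0 scaleN1r addNr. Qed.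

Lemma matrix_systemD p q b b' : th p q (b + b') = th p q b + th p q b'.
Proof. by have := thl p q 1 b b'; rewrite !scale1r. Qed.

Lemma matrix_systemZ p q a b : th p q (a *: b) = a *: th p q b.
Proof. by have := thl p q a b 0; rewrite matrix_system0 !addr0. Qed.

Lemma matrix_system_sum p q I (r : seq I) (Pr : pred I) (F : I -> B) :
  th p q (\sum_(i <- r | Pr i) F i) = \sum_(i <- r | Pr i) th p q (F i).
Proof.
by apply: (big_morph (th p q)) => [u v|];
  rewrite ?matrix_systemD ?matrix_system0.
Qed.

Lemma matrix_sum_cat l l' : matrix_sum th (l ++ l') = matrix_sum th l + matrix_sum th l'.
Proof. exact: big_cat. Qed.

Lemma matrix_sum_scale a l :
  matrix_sum th [seq (i.1, a *: i.2) | i <- l] = a *: matrix_sum th l.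
Proof.
rewrite /matrix_sum big_map scaler_sumr; apply: eq_bigr => i _.
by rewrite matrix_systemZ.
Qed.

(** The list on the right depends neither on [D] nor on [th], so one list describes [x^* x] in two
    systems simultaneously. This makes the relation in [matrix_system_contraction] stable under
    squaring. *)
Lemma matrix_sum_star_mul l :
  cmul (cstar (matrix_sum th l)) (matrix_sum th l) =
  matrix_sum th [seq ((i.1.2, j.1.2),
                if i.1.1 == j.1.1 then cmul (cstar i.2) j.2 else 0)
          | i <- l, j <- l].
Proof.
rewrite /matrix_sum big_allpairs_dep/= cstar_sum cmul_suml; apply: eq_bigr => i _.
rewrite cmul_sumr; apply: eq_bigr => j _; rewrite thV thM.
by case: ifP => // _; rewrite matrix_system0.
Qed.

Lemma matrix_sum_mul_star l :
  cmul (matrix_sum th l) (cstar (matrix_sum th l)) =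
  \sum_(i <- l) \sum_(j <- l)
    if i.1.2 == j.1.2 then th i.1.1 j.1.1 (cmul i.2 (cstar j.2)) else 0.
Proof.
rewrite /matrix_sum cstar_sum cmul_suml; apply: eq_bigr => i _.
by rewrite cmul_sumr; apply: eq_bigr => j _; rewrite thV thM.
Qed.

Lemma matrix_sum_group (F : seq G) l : uniq F ->
  (forall i, i \in l -> i.1.1 \in F /\ i.1.2 \in F) ->
  matrix_sum th l = \sum_(p <- F) \sum_(q <- F) th p q (coef l p q).
Proof.
move=> uF lF.
transitivity (\sum_(i <- l) \sum_(p <- F) \sum_(q <- F | i.1 == (p, q)) th p q i.2).
  rewrite /matrix_sum !big_seq; apply: eq_bigr => -[[r s] b] /lF[/= rF sF].
  rewrite (bigD1_seq r)//= [X in _ + X]big1 ?addr0 => [|p /negPf pr]; last first.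
    by rewrite big1// => q; rewrite xpair_eqE eq_sym pr.
  rewrite big_mkcond (bigD1_seq s)//= eqxx big1 ?addr0// => q /negPf qs.
  by rewrite xpair_eqE (eq_sym s) qs andbF.
rewrite exchange_big/=; apply: eq_bigr => p _.
rewrite (exchange_big_dep xpredT)//=; apply: eq_bigr => q _.
by rewrite /coef matrix_system_sum.
Qed.

End OneSystem.

(** With [h = b^* b] and [c = h b^*] one has [c c^* = h^3]; since [h^4] has norm [|b|^8] and is
    [h^3] times [h], it follows that [|b|^8 <= |c|^2 |b|^2]. This stands in for an approximate unit
    when a single entry has to be recovered. *)
Lemma nrm_cube (b : B) : nrm b ^+ 3 <= nrm (cmul (cmul (cstar b) b) (cstar b)).
Proof.
set c := cmul (cmul _ _) _; set h := cmul (cstar b) b.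
have hs : cstar h = h by rewrite cstarM cstarK.
have [b0|bn0] := eqVneq (nrm b) 0; first by rewrite b0 expr0n nrm_ge0.
have bp : 0 < nrm b by rewrite lt_neqAle eq_sym bn0 nrm_ge0.
have nh : nrm h = nrm b ^+ 2 by rewrite nrm_star_mul.
have nh2 : nrm (cmul h h) = nrm b ^+ 4 by rewrite -{1}hs nrm_star_mul nh -exprM.
have nh4 : nrm (cmul (cmul h h) (cmul h h)) = nrm b ^+ 8.
  have hhs : cstar (cmul h h) = cmul h h by rewrite cstarM hs.
  by rewrite -{1}hhs nrm_star_mul nh2 -exprM.
have cc : cmul c (cstar c) = cmul (cmul h h) h.
  by rewrite /c !cstarM !cstarK /h !cmulA.
have cn : nrm c ^+ 2 = nrm (cmul (cmul h h) h) by rewrite -nrm_mul_star cc.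
rewrite -(@ler_pXn2r _ 2) ?nnegrE ?nrm_ge0 ?exprn_ge0 ?nrm_ge0// cn.
rewrite -exprM -(ler_pM2r (exprn_gt0 2 bp)) -exprD -nh4 -nh.
by rewrite cmulA nrm_mul.
Qed.

(** Multiplying the matrix by [b^*] at [(p, p)] on the left and at [(q, q)] on the right leaves only
    [b^* b b^*] at [(p, q)]. By [nrm_cube] this gives [|b|^3 <= |b| |x| |b|]. *)
Lemma coef_bound (D : cstarAlgType R) (ta : G -> G -> B -> D) l p q :
  matrix_system ta -> (forall p q b, nrm (ta p q b) = nrm b) ->
  nrm (coef l p q) <= nrm (matrix_sum ta l).
Proof.
move=> taS tan; have [_ taM _ _] := taS.
set b := coef l p q; set x := matrix_sum ta l.
have e : cmul (ta p p (cstar b)) (cmul x (ta q q (cstar b))) =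
    ta p q (cmul (cmul (cstar b) b) (cstar b)).
  rewrite cmul_suml cmul_sumr.
  have -> : ta p q (cmul (cmul (cstar b) b) (cstar b)) =
      \sum_(i <- l | i.1 == (p, q)) ta p q (cmul (cmul (cstar b) i.2) (cstar b)).
    by rewrite {2}/b /coef cmul_sumr cmul_suml matrix_system_sum.
  rewrite [RHS]big_mkcond.
  apply: eq_bigr => -[[r s] b'] _ /=; rewrite taM xpair_eqE (eq_sym r).
  case: (eqVneq s q) => [_|_]; last by rewrite andbF cmul0r.
  by rewrite taM andbT; case: ifP => // _; rewrite cmulA.
have := nrm_cube b; rewrite -(tan p q (cmul (cmul _ _) _)) -e => /le_trans.
have := nrm_mul (ta p p (cstar b)) (cmul x (ta q q (cstar b))).
rewrite tan nrm_star => h1 /(_ _ h1).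
have /(ler_wpM2l (nrm_ge0 b)) := nrm_mul x (ta q q (cstar b)).
rewrite tan nrm_star => h2 /le_trans/(_ h2).
have [->|bn0] := eqVneq (nrm b) 0; first by rewrite nrm_ge0.
have bp : 0 < nrm b by rewrite lt_neqAle eq_sym bn0 nrm_ge0.
by rewrite exprS ler_pM2l// expr2 ler_pM2r.
Qed.

Lemma matrix_system_contraction (D E : cstarAlgType R) (th : G -> G -> B -> D)
    (ta : G -> G -> B -> E) l :
  matrix_system th -> matrix_system ta -> (forall p q b, nrm (ta p q b) = nrm b) ->
  nrm (matrix_sum th l) <= nrm (matrix_sum ta l).
Proof.
move=> thS taS tan; have [_ _ _ thn] := thS.
(* All labels occurring in [l]. Passing to [x^* x] creates no new labels, so the constant
   [(size F)^2], the number of possible entries, survives every squaring. *)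
pose F := undup ([seq i.1.1 | i <- l] ++ [seq i.1.2 | i <- l]).
pose inF (l' : seq (G * G * B)) := forall i : G * G * B, i \in l' -> i.1.1 \in F /\ i.1.2 \in F.
have lF : inF l.
  by move=> i il; split; rewrite mem_undup mem_cat; apply/orP;
    [left|right]; apply/mapP; exists i.
pose Z x y := exists2 l', inF l' & x = matrix_sum th l' /\ y = matrix_sum ta l'.
apply: (@nrm_le_of_squaring _ _ _ Z ((size F)%:R * (size F)%:R)); last by exists l.
  move=> _ _ [l' l'F [-> ->]]; eexists; last by split; apply: matrix_sum_star_mul.
  by move=> i /allpairsP [[j k] [/l'F[_ ?] /l'F[_ ?] ->]].
move=> _ _ [l' l'F [-> ->]].
rewrite (matrix_sum_group thS (undup_uniq _) l'F).
apply: le_trans (nrm_sum _ _) _.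
have const (c : R) : \sum_(p <- F) c = (size F)%:R * c.
  by rewrite big_const_seq count_predT iter_addr addr0 mulr_natl.
rewrite -mulrA -const; apply: ler_sum => p _.
apply: le_trans (nrm_sum _ _) _.
rewrite -const; apply: ler_sum => q _.
exact: le_trans (thn _ _ _) (coef_bound _ _ _ taS tan).
Qed.

(** In [matrix_sum_mul_star] the column labels enter only through equality tests, which an injective
    relabelling preserves. *)
Lemma matrix_sum_shift (D : cstarAlgType R) (th : G -> G -> B -> D) (sg : G -> G) l :
  matrix_system th -> injective sg ->
  nrm (matrix_sum th [seq ((i.1.1, sg i.1.2), i.2) | i <- l]) = nrm (matrix_sum th l).
Proof.
move=> thS sgI; apply/eqP; rewrite -(@eqrXn2 _ 2) ?nrm_ge0// -!nrm_mul_star.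
apply/eqP; congr nrm; rewrite !matrix_sum_mul_star// big_map; apply: eq_bigr => i _.
by rewrite big_map; apply: eq_bigr => j _ /=; rewrite (inj_eq sgI).
Qed.

End MatrixUnits.

(** * Inverses and fibres in a groupoid *)

Section GroupoidAlgebra.
Variables (Q : Type) (X : groupoid Q).

Lemma ginvK x : ginv X (ginv X x) = x.
Proof.
set y := ginv X x; have yx : gsrc X y = grng X x by rewrite gsrcV.
rewrite -[LHS](gmul_src X) gsrcV /y grngV -gmulVx.
rewrite gmulA ?gmulVx ?gsrcV ?gmul_rng ?grngV//.
Qed.

Lemma grngVM x y : grng X y = grng X x -> grng X (gmul X (ginv X y) x) = gsrc X y.
Proof. by move=> yx; rewrite grngM ?grngV// gsrcV. Qed.

Lemma gmulKV x y : grng X y = grng X x -> gmul X y (gmul X (ginv X y) x) = x.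
Proof.
by move=> yx; rewrite gmulA ?grngV// ?gsrcV// gmulV yx gmul_rng.
Qed.

End GroupoidAlgebra.

(** * Compactly supported functions on topological spaces *)

Lemma closed_eq_fun (T Y : topologicalType) (f g : T -> Y) :
  hausdorff_space Y -> continuous f -> continuous g -> closed [set x | f x = g x].
Proof.
rewrite open_hausdorff => hY fc gc; rewrite -openC openE => x /= /eqP fg.
have [[A B] /= [/set_mem fA /set_mem gB] [oA oB /eqP AB]] := hY _ _ fg.
have h1 : \forall y \near x, A (f y) by apply: fc; exact: open_nbhs_nbhs.
have h2 : \forall y \near x, B (g y) by apply: gc; exact: open_nbhs_nbhs.
near=> y => /= fgy; have : (A `&` B) (f y).
  by split; [near: y|rewrite fgy; near: y].
by rewrite AB.
Unshelve. all: by end_near. Qed.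

Lemma near_neq (T Y : topologicalType) (F : set_system T) (f g : T -> Y) (a b : Y) :
  hausdorff_space Y -> Filter F -> f @ F --> a -> g @ F --> b -> a <> b ->
  \forall x \near F, f x <> g x.
Proof.
rewrite open_hausdorff => hY FF fa gb /eqP ab.
have [[A B] /= [/set_mem aA /set_mem bB] [oA oB /eqP AB]] := hY _ _ ab.
have h1 : \forall y \near F, A (f y) by apply: fa; exact: open_nbhs_nbhs.
have h2 : \forall y \near F, B (g y) by apply: gb; exact: open_nbhs_nbhs.
near=> y => /= fgy; have : (A `&` B) (f y).
  by split; [near: y|rewrite fgy; near: y].
by rewrite AB.
Unshelve. all: by end_near. Qed.

Lemma near_all (T : Type) (I : eqType) (F : set_system T) (s : seq I)
    (Pr : I -> T -> Prop) : Filter F ->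
  (forall i, i \in s -> \forall x \near F, Pr i x) ->
  \forall x \near F, forall i, i \in s -> Pr i x.
Proof.
move=> FF; elim: s => [|i s ih] sP; first by apply: nearW.
have h1 := sP i (mem_head _ _).
have h2 : \forall x \near F, forall i, i \in s -> Pr i x.
  by apply: ih => j js; apply: sP; rewrite inE js orbT.
by apply: filterS2 h1 h2 => x xi xs j; rewrite inE => /predU1P[->|/xs].
Qed.

Lemma cvg_sum_seq (K : numFieldType) (V : normedModType K) (T : Type)
    (I : eqType) (F : set_system T) (s : seq I) (f : I -> T -> V) (l : I -> V) :
  Filter F -> (forall i, i \in s -> f i @ F --> l i) ->
  (fun x => \sum_(i <- s) f i x) @ F --> \sum_(i <- s) l i.
Proof.
move=> FF; elim: s => [|i s ih] fl.
  by under eq_fun do rewrite big_nil; rewrite big_nil; exact: cvg_cst.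
under eq_fun do rewrite big_cons; rewrite big_cons.
apply: cvgD; first by apply: fl; rewrite mem_head.
by apply: ih => j js; apply: fl; rewrite inE js orbT.
Qed.

Lemma compact_finite_nbhs (T : topologicalType) (K : set T) (f : T -> set T) :
  compact K -> (forall y, K y -> nbhs y (f y)) ->
  exists s : seq T, forall x, K x -> exists2 y, y \in s & f y x.
Proof.
move=> /compact_near_coveringP cK fK.
(* The filter of finite lists ordered by inclusion: eventually a list contains any given centre, so
   the near-covering form of compactness yields one list serving all points. *)
pose F : set_system (seq T) :=
  [set A : set (seq T) | exists s0 : seq T, forall s : seq T, {subset s0 <= s} -> A s].
have FF : Filter F.
  split; first by exists [::].
    move=> A B [s0 sA] [s1 sB]; exists (s0 ++ s1) => s ss; split.
      by apply: sA => x xs; apply: ss; rewrite mem_cat xs.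
    by apply: sB => x xs; apply: ss; rewrite mem_cat xs orbT.
  by move=> A B AB [s0 sA]; exists s0 => s /sA /AB.
have [|s0 /(_ s0)] := cK _ F (fun (s : seq T) x => exists2 y, y \in s & f y x) FF.
  move=> y Ky; exists (f y, [set s : seq T | y \in s]) => /=.
    split; first exact: fK.
    by exists [:: y] => s; apply; rewrite inE.
  by move=> [x s] [/= fyx ys]; exists y.
by move=> s0P; exists s0; exact: s0P.
Qed.

Section CompactSupport.
Variables (R : realType) (Y : topologicalType).
Implicit Types f g h : Y -> R[i]^o.

Definition Cc f := continuous f /\ compactly_supported f.

Lemma compactly_supported_sub f (K : set Y) : hausdorff_space Y -> compact K ->
  (forall x, f x != 0 -> K x) -> compactly_supported f.
Proof.
move=> hY cK fK; apply: (subclosed_compact (@closed_closure _ _) cK).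
have /closure_id -> : closed K by apply: compact_closed.
exact: closure_subset.
Qed.

Lemma closure_supp f x : f x != 0 -> closure [set x | f x != 0] x.
Proof. by move=> fx; apply: subset_closure. Qed.

Lemma compactly_supported_subU f g h : 
  compactly_supported f -> compactly_supported g ->
  (forall x, h x != 0 -> f x != 0 \/ g x != 0) -> compactly_supported h.
Proof.
move=> cf cg hfg; apply: (subclosed_compact (@closed_closure _ _) (compactU cf cg)).
by rewrite -closureU; apply: closure_subset => x /hfg.
Qed.

Lemma Cc0 : Cc 0.
Proof.
split; first by move=> x; exact: cvg_cst.
rewrite /compactly_supported (_ : [set x | _] = set0).
  by rewrite closure0; exact: compact0.
by apply/seteqP; split => // x /=; rewrite eqxx.
Qed.

Lemma CcZD (a : R[i]) f g : Cc f -> Cc g -> Cc (a *: f + g).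
Proof.
move=> [fc fs] [gc gs]; split.
  move=> x; apply: (@cvgD _ _ _ _ _ (fun y => a *: f y) g); last exact: gc.
  by apply: cvgZr; exact: fc.
apply: (compactly_supported_subU fs gs) => x /=.
rewrite !fctE; case: (eqVneq (f x) 0) => [->|]; last by left.
by rewrite scaler0 add0r; right.
Qed.

Lemma CcD f g : Cc f -> Cc g -> Cc (f + g).
Proof. by move=> fC gC; rewrite -[f]scale1r; exact: CcZD. Qed.

End CompactSupport.

(** * Functions graded by a locally constant degree *)

Section Graded.
Variables (R : realType) (Y : topologicalType) (I : choiceType).
Variables (d : Y -> discrete_topology I).
Hypothesis dc : continuous d.
Implicit Types f g h : Y -> R[i]^o.

Definition hpart (i : I) f : Y -> R[i]^o := fun x => if d x == i :> I then f x else 0.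

Definition homog (i : I) f := forall x, f x != 0 -> d x = i.

Lemma near_deg x : \forall y \near x, d y = d x.
Proof. exact: (dc (discrete_set1 (d x))). Qed.

Lemma hpart_homog i f : homog i (hpart i f).
Proof. by move=> x; rewrite /hpart; case: ifP => [/eqP->//|_]; rewrite eqxx. Qed.

Lemma hpart_continuous i f : continuous f -> continuous (hpart i f).
Proof.
move=> fc x; have [xi|xi] := eqVneq (d x : I) i.
  have cx : hpart i f x = f x by rewrite /hpart xi eqxx.
  have h : \forall y \near x, f y = hpart i f y.
    by apply: filterS (near_deg x) => y yx; rewrite /hpart yx xi eqxx.
  rewrite /continuous_at cx; apply: cvg_trans (fc x).
  by apply: near_eq_cvg; exact: h.
have cx : hpart i f x = 0 by rewrite /hpart (negPf xi).
have h : \forall y \near x, cst 0 y = hpart i f y.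
  by apply: filterS (near_deg x) => y yx; rewrite /hpart yx (negPf xi).
rewrite /continuous_at cx; apply: (@cvg_trans _ (cst (0 : R[i]^o) @ x)).
  by apply: near_eq_cvg; exact: h.
exact: cvg_cst.
Qed.

Lemma hpart_Cc i f : Cc f -> Cc (hpart i f).
Proof.
move=> [fc fs]; split; first exact: hpart_continuous.
apply: (compactly_supported_subU fs fs) => x.
by rewrite /hpart; case: ifP => _; [left|rewrite eqxx].
Qed.

Lemma hpartZD i (a : R[i]) f g : hpart i (a *: f + g) = a *: hpart i f + hpart i g.
Proof.
by apply/funext => x; rewrite /hpart !fctE; case: ifP => // _; rewrite scaler0 addr0.
Qed.

Lemma hpart_id i f : homog i f -> hpart i f = f.
Proof.
move=> fi; apply/funext => x; rewrite /hpart; case: eqP => // /eqP xi.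
apply/esym/eqP; apply: contraTT xi => /fi ->.
by rewrite eqxx.
Qed.

Lemma hpart_ne i j f : homog i f -> i != j -> hpart j f = 0.
Proof.
move=> fi ij; apply/funext => x; rewrite /hpart; case: eqP => // xj.
by apply/eqP; apply: contraTT ij => /fi <-; rewrite xj negbK.
Qed.

(** Finitely many of the open sets on which [d] is constant cover the compact support. *)
Lemma Cc_deg_finite f : Cc f -> finite_set [set i | hpart i f != 0].
Proof.
move=> [_ fs]; have [y|s scov] := compact_finite_nbhs fs (f := fun y => [set x | d x = d y]).
  by move=> _; exact: near_deg.
apply: (sub_finite_set _ (finite_seq [seq (d y : I) | y <- s])) => i /= /eqP fi.
apply: contrapT => iD; apply: fi; apply/funext => x; rewrite /hpart.
case: ifP => // /eqP xi; apply/eqP; apply: contrapT => /negP fx.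
have [y ys xy] := scov _ (closure_supp fx).
by apply: iD; apply/mapP; exists y => //; rewrite -xi.
Qed.

Lemma Cc_hpart_sum f : Cc f -> exists s : seq I, uniq s /\
  (forall i, i \notin s -> hpart i f = 0) /\ f = \sum_(i <- s) hpart i f.
Proof.
move=> fC; have fin := Cc_deg_finite fC.
exists (enum_fset (fset_set [set i | hpart i f != 0])); split; first exact: fset_uniq.
have out i : i \notin enum_fset (fset_set [set i | hpart i f != 0]) -> hpart i f = 0.
  rewrite in_fset_set// => /negP iN; apply/eqP; apply: contrapT => /negP fi.
  by apply: iN; rewrite inE.
split => //; apply/funext => x; rewrite fct_sumE.
have cx : hpart (d x) f x = f x by rewrite /hpart eqxx.
have [xs|xs] := boolP ((d x : I) \in enum_fset (fset_set [set i | hpart i f != 0])).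
  rewrite (bigD1_seq _ xs)//= big1 ?addr0// => i ix.
  by rewrite /hpart eq_sym (negPf ix).
rewrite big1_seq.
  by rewrite -cx out.
move=> i /= iS; rewrite /hpart; case: eqP => // xi.
by rewrite xi iS in xs.
Qed.

Lemma Cc_homog_ind (Pr : (Y -> R[i]^o) -> Prop) :
  Pr 0 -> (forall f g, Cc f -> Cc g -> Pr f -> Pr g -> Pr (f + g)) ->
  (forall i f, Cc f -> homog i f -> Pr f) -> forall f, Cc f -> Pr f.
Proof.
move=> P0 PD Ph f fC; have [s [_ [_ ->]]] := Cc_hpart_sum fC.
suff [] : Cc (\sum_(i <- s) hpart i f) /\ Pr (\sum_(i <- s) hpart i f) by [].
apply: (big_ind (fun g => Cc g /\ Pr g)) => [|g h [gC gP] [hC hP]|i _].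
- by split => //; exact: Cc0.
- by split; [exact: CcD | exact: PD].
- by split; [exact: hpart_Cc | apply: (Ph i); [exact: hpart_Cc | exact: hpart_homog]].
Qed.

Section GradedSum.
Variables (D : lmodType R[i]) (L : I -> (Y -> R[i]^o) -> D).
Hypothesis LZD : forall i (a : R[i]) f g, Cc f -> Cc g ->
  L i (a *: f + g) = a *: L i f + L i g.

(** Glues linear maps, one for each degree, into one map. Only finitely many terms are nonzero on
    [C_c], and on a function of degree [i] the result is [L i]. *)
Definition graded_sum f : D := \sum_(i \in [set: I]) L i (hpart i f).

Lemma graded_L0 i : L i 0 = 0.
Proof.
have := LZD i (-1) (Cc0 R Y) (Cc0 R Y).
by rewrite scaler0 addr0 scaleN1r addNr.
Qed.

Lemma graded_sumE f (s : seq I) : uniq s ->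
  (forall i, i \notin s -> hpart i f = 0) ->
  graded_sum f = \sum_(i <- s) L i (hpart i f).
Proof.
move=> us sf; rewrite /graded_sum (@fsbigE _ _ _ _ _ s _ us)//.
  by apply: eq_bigl => i; rewrite in_setT.
by move=> i _ /sf ->; exact: graded_L0.
Qed.

Lemma graded_sumZD (a : R[i]) f g : Cc f -> Cc g ->
  graded_sum (a *: f + g) = a *: graded_sum f + graded_sum g.
Proof.
move=> fC gC; have [s [us [sf _]]] := Cc_hpart_sum fC.
have [t [ut [tg _]]] := Cc_hpart_sum gC.
pose w := undup (s ++ t).
have uw : uniq w := undup_uniq _.
have wf i : i \notin w -> hpart i f = 0.
  by rewrite mem_undup mem_cat negb_or => /andP[/sf].
have wg i : i \notin w -> hpart i g = 0.
  by rewrite mem_undup mem_cat negb_or => /andP[_ /tg].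
rewrite (graded_sumE uw wf) (graded_sumE uw wg) (@graded_sumE _ w)//; last first.
  by move=> i iw; rewrite hpartZD wf// wg// scaler0 addr0.
rewrite scaler_sumr -big_split; apply: eq_bigr => i _.
by rewrite hpartZD LZD//; exact: hpart_Cc.
Qed.

Lemma graded_sum_homog i f : homog i f -> graded_sum f = L i f.
Proof.
move=> fi; rewrite (@graded_sumE _ [:: i])//.
  by rewrite big_seq1 hpart_id.
by move=> j; rewrite inE => ji; apply: (hpart_ne fi); rewrite eq_sym.
Qed.

End GradedSum.

End Graded.

(** * Convolution on r-discrete groupoids *)

Section Convolution.
Variables (R : realType) (Q : topologicalType) (X : groupoid Q).
Implicit Types f g h : Q -> R[i]^o.

Definition gconv f g : Q -> R[i]^o := fun x =>
  \sum_(y \in gfiber X (grng X x)) f y * g (gmul X (ginv X y) x).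

Definition fstar f : Q -> R[i]^o := fun x => (f (ginv X x))^*%C.

(* Finiteness matters: [\sum_(y \in A)] is [0] when its support is infinite. *)
Definition fibre_finite f := forall u, finite_set [set y | gfiber X u y /\ f y != 0].

(** The list may be larger than the support, so several functions can share one list; this is how
    linearity and continuity of the convolution are reached. *)
Lemma gconv_seq f g x (s : seq Q) : uniq s ->
  (forall y, y \in s -> grng X y = grng X x) ->
  (forall y, grng X y = grng X x -> f y != 0 -> y \in s) ->
  gconv f g x = \sum_(y <- s) f y * g (gmul X (ginv X y) x).
Proof.
move=> us sx fs; rewrite /gconv (@fsbigE _ _ _ _ _ s _ us)//.
  rewrite big_seq_cond [RHS]big_seq; apply: eq_bigl => y.
  by case ys : (y \in s) => //=; rewrite mem_set//; exact: sx.
move=> y yx ys; have [->|fy] := eqVneq (f y) 0; first by rewrite mul0r.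
by rewrite fs in ys.
Qed.

Lemma fibre_finite_seq f u : fibre_finite f -> exists s : seq Q, [/\ uniq s,
  forall y, y \in s -> grng X y = u & forall y, grng X y = u -> f y != 0 -> y \in s].
Proof.
move=> /(_ u) fu; exists (enum_fset (fset_set [set y | gfiber X u y /\ f y != 0])).
split; first exact: fset_uniq.
  by move=> y; rewrite in_fset_set// inE => -[].
by move=> y yu fy; rewrite in_fset_set// inE.
Qed.

Lemma gconvZDl (a : R[i]) f g h : fibre_finite f -> fibre_finite g ->
  gconv (a *: f + g) h = a *: gconv f h + gconv g h.
Proof.
move=> ff gf; apply/funext => x; rewrite !fctE.
have [s [us sx fs]] := fibre_finite_seq (grng X x) ff.
have [t [ut tx gt]] := fibre_finite_seq (grng X x) gf.
pose w := undup (s ++ t).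
have uw : uniq w := undup_uniq _.
have wx y : y \in w -> grng X y = grng X x.
  by rewrite mem_undup mem_cat => /orP[/sx|/tx].
have wf y : grng X y = grng X x -> f y != 0 -> y \in w.
  by move=> yx fy; rewrite mem_undup mem_cat fs.
have wg y : grng X y = grng X x -> g y != 0 -> y \in w.
  by move=> yx fy; rewrite mem_undup mem_cat (gt y)// orbT.
rewrite (gconv_seq h uw wx wf) (gconv_seq h uw wx wg) (@gconv_seq _ _ _ w)//; last first.
  move=> y yx fgy; have [f0|] := eqVneq (f y) 0; last exact: wf.
  by apply: wg => //; move: fgy; rewrite f0 scaler0 add0r.
rewrite scaler_sumr -big_split; apply: eq_bigr => y _.
by rewrite mulrDl scalerAl.
Qed.

Lemma gconvZDr (a : R[i]) f g h : fibre_finite h ->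
  gconv h (a *: f + g) = a *: gconv h f + gconv h g.
Proof.
move=> hf; apply/funext => x; rewrite !fctE.
have [s [us sx hs]] := fibre_finite_seq (grng X x) hf.
rewrite !(gconv_seq _ us sx hs) scaler_sumr -big_split; apply: eq_bigr => y _.
by rewrite mulrDr scalerAr.
Qed.

Lemma gconv0l h : gconv 0 h = 0.
Proof. by apply/funext => x; rewrite /gconv fsbig1// => y _; rewrite mul0r. Qed.

Lemma gconv0r h : gconv h 0 = 0.
Proof. by apply/funext => x; rewrite /gconv fsbig1// => y _; rewrite mulr0. Qed.

Lemma gconvDl f g h : fibre_finite f -> fibre_finite g ->
  gconv (f + g) h = gconv f h + gconv g h.
Proof. by move=> ff gf; have := gconvZDl 1 h ff gf; rewrite !scale1r. Qed.

Lemma gconvDr f g h : fibre_finite h -> gconv h (f + g) = gconv h f + gconv h g.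
Proof. by move=> hf; have := gconvZDr 1 f g hf; rewrite !scale1r. Qed.

Lemma gconv_neq0 f g x : gconv f g x != 0 ->
  exists y, [/\ grng X y = grng X x, f y != 0 & g (gmul X (ginv X y) x) != 0].
Proof.
move=> /eqP fg; apply: contrapT => no; apply: fg; apply: fsbig1 => y yx.
apply/eqP; rewrite mulf_eq0; apply: contrapT => /negP; rewrite negb_or => /andP[fy gy].
by apply: no; exists y.
Qed.

Lemma fstarD f g : fstar (f + g) = fstar f + fstar g.
Proof. by apply/funext => x; rewrite /fstar !fctE rmorphD. Qed.

Lemma fstar0 : fstar 0 = 0.
Proof. by apply/funext => x; exact: (@conjc0 R). Qed.

End Convolution.

Lemma continuous_conjc (R : realType) : continuous (fun z : R[i]^o => (z^*%C : R[i]^o)).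
Proof.
move=> z A /nbhs_ballP[e /= e0 eA]; apply/nbhs_ballP; exists e => //= w.
rewrite -ball_normE /= => zw; apply: eA; rewrite -ball_normE /=.
by rewrite -rmorphB/= normcJ.
Qed.

Section Etale.
Variables (R : realType) (Q : topologicalType) (X : groupoid Q).
Hypothesis Q_groupoid : topological_groupoid X.
Hypothesis Q_hausdorff : hausdorff_space Q.
Hypothesis Q_r_discrete : r_discrete X.
Implicit Types f g h : Q -> R[i]^o.

Lemma continuous_ginv : continuous (ginv X).
Proof. by case: Q_groupoid. Qed.

(* [e y] is the local inverse of the range map through [y]. *)
Lemma etale_sections : exists (U : Q -> set Q) (e : Q -> Q -> Q), forall y,
  [/\ nbhs y (U y), {within grng X @` U y, continuous (e y)},
      forall z, U y z -> e y (grng X z) = z &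
      exists2 V, nbhs (grng X y) V & gunits X `&` V `<=` grng X @` U y].
Proof.
have : forall y, exists Ue : set Q * (Q -> Q),
  [/\ nbhs y Ue.1, {within grng X @` Ue.1, continuous Ue.2},
      forall z, Ue.1 z -> Ue.2 (grng X z) = z &
      exists2 V, nbhs (grng X y) V & gunits X `&` V `<=` grng X @` Ue.1].
  move=> y; have [_ /(_ y) [U [V [e [[oU Uy] [oV rUV] _ ec eK]]]]] := Q_r_discrete.
  exists (U, e); split => //=; first exact: open_nbhs_nbhs.
  exists V; last by rewrite rUV.
  apply: open_nbhs_nbhs; split => //.
  have : (grng X @` U) (grng X y) by exists y.
  by rewrite rUV => -[].
move=> /choice[Ue UeP]; exists (fun y => (Ue y).1), (fun y => (Ue y).2) => y.
exact: UeP.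
Qed.

Lemma continuous_grng : continuous (grng X).
Proof.
move=> y; have [_ /(_ y) [U [V [e [[oU Uy] _ rc _ _]]]]] := Q_r_discrete.
move: rc; rewrite continuous_open_subspace// => rc.
by apply: rc; rewrite inE.
Qed.

Lemma continuous_gsrc : continuous (gsrc X).
Proof.
move=> x; have -> : gsrc X = grng X \o ginv X by apply/funext => y /=; rewrite grngV.
apply: continuous_comp; [exact: continuous_ginv | exact: continuous_grng].
Qed.

(** The range map is injective on each [U y], so each of the finitely many sets covering [K] meets
    the fibre at most in the point [e y u]. *)
Lemma compact_fibre_finite (K : set Q) u : compact K ->
  finite_set [set y | gfiber X u y /\ K y].
Proof.
move=> cK; have [U [e Ue]] := etale_sections.
have [|s scov] := compact_finite_nbhs cK (f := U).
  by move=> y _; have [] := Ue y.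
apply: (sub_finite_set _ (finite_seq [seq e y u | y <- s])) => z /= [zu Kz].
have [y ys Uz] := scov _ Kz; have [_ _ eK _] := Ue y.
by apply/mapP; exists y => //; rewrite -zu eK.
Qed.

Lemma Cc_fibre_finite f : Cc f -> fibre_finite X f.
Proof.
move=> [_ fs] u; apply: (sub_finite_set _ (compact_fibre_finite u fs)).
by move=> y [yu fy]; split => //; exact: closure_supp.
Qed.

(** Let [Y0] be the points of the support over the range of [x0]. Near [x0], the support over the
    range of [x] lies among the points [e y (grng X x)] with [y] in [Y0]; the convolution is then a
    fixed finite sum of terms continuous at [x0]. *)
Lemma gconv_continuous f g : Cc f -> continuous g -> continuous (gconv X f g).
Proof.
move=> fC gc x0; have [fc fs] := fC.
set K := closure [set x | f x != 0] in fs.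
have [U [e Ue]] := etale_sections.
set u0 := grng X x0.
pose Y0 := enum_fset (fset_set [set y | gfiber X u0 y /\ K y]).
have uY0 : uniq Y0 by exact: fset_uniq.
have Y0P y : y \in Y0 -> grng X y = u0.
  by rewrite in_fset_set; [rewrite inE => -[]|exact: compact_fibre_finite].
have Y0K y : grng X y = u0 -> K y -> y \in Y0.
  by move=> yu Ky; rewrite in_fset_set; [rewrite inE|exact: compact_fibre_finite].
have nearV : \forall x \near x0, forall y, y \in Y0 -> (grng X @` U y) (grng X x).
  apply: near_all => y yY; have [_ _ _ [V + VU]] := Ue y.
  rewrite (Y0P y yY) => uV; have : nbhs x0 (grng X @^-1` V).
    exact: (@continuous_grng x0 _ uV).
  apply: filterS => x /= Vx.
  by apply: VU; split => //; exists x.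
(* A point of [K] with range [u0] lies in [Y0]; any other point has a range separated from [u0], and
   hence from the range of [x] close to [x0]. Compactness of [K] makes this uniform. *)
have nearK : \forall x \near x0, forall y, K y -> grng X y = grng X x ->
    exists2 i, i \in Y0 & U i y.
  have /compact_near_coveringP := fs.
  move=> /(_ _ (nbhs x0) (fun x y => grng X y = grng X x ->
    exists2 i, i \in Y0 & U i y)); apply.
  move=> y Ky; have [yu|yu] := pselect (grng X y = u0).
    have [Uy _ _ _] := Ue y.
    exists (U y, setT) => /=; first by split => //; exact: filterT.
    move=> [z x] /= [Uz _] _; exists y => //.
    exact: Y0K.
  have : \forall p \near (nbhs y, nbhs x0), grng X p.1 <> grng X p.2.
    apply: (@near_neq _ _ (filter_prod (nbhs y) (nbhs x0)) (grng X \o fst)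
      (grng X \o snd) (grng X y) u0 Q_hausdorff _ _ _ yu).
      apply: (@cvg_comp _ _ _ fst (grng X) _ (nbhs y)); first exact: cvg_fst.
      exact: continuous_grng.
    apply: (@cvg_comp _ _ _ snd (grng X) _ (nbhs x0)); first exact: cvg_snd.
    exact: continuous_grng.
  by apply: filterS => -[z x] /= zx /zx.
have ec y : y \in Y0 -> (e y \o grng X) @ x0 --> y.
  move=> yY; have [Uy ec eK [V yV VU]] := Ue y.
  have yx : grng X y = u0 := Y0P y yY.
  have rUu : (grng X @` U y) u0 by exists y => //; exact: nbhs_singleton.
  have e0 : e y u0 = y by rewrite -yx eK//; exact: nbhs_singleton.
  rewrite -[in X in _ --> X]e0.
  apply: (@cvg_comp _ _ _ (grng X) (e y) _ (within (grng X @` U y) (nbhs u0))).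
    move=> A; rewrite /within/= => hA.
    have h : \forall x \near x0, (grng X @` U y) (grng X x) -> A (grng X x).
      exact: (@continuous_grng x0 _ hA).
    by apply: filterS2 h nearV => x xA xU; apply: xA; exact: xU.
  by move/subspace_continuousP : ec; apply.
(* Sections starting at different points stay apart near [x0], so no point of the fibre is counted
   twice in [S]. *)
have nearD : \forall x \near x0, forall p, p \in [seq (y, z) | y <- Y0, z <- Y0] ->
    p.1 != p.2 -> e p.1 (grng X x) <> e p.2 (grng X x).
  apply: near_all => _ /allpairsP[[y z] [/= yY zY ->]] /=.
  have [->|yz] := eqVneq y z; first by apply: nearW.
  have := near_neq Q_hausdorff (nbhs_filter x0) (ec y yY) (ec z zY) (elimN eqP yz).
  by apply: filterS => x /=.
pose S x := \sum_(y <- Y0) f (e y (grng X x)) * g (gmul X (ginv X (e y (grng X x))) x).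
have nearS : \forall x \near x0, S x = gconv X f g x.
  apply: filterS3 nearV nearK nearD => x xV xK xD.
  rewrite /S (@gconv_seq _ _ _ _ _ _ [seq e y (grng X x) | y <- Y0]).
  - by rewrite big_map.
  - rewrite map_inj_in_uniq// => y z yY zY yz; apply/eqP; apply: contrapT => /negP nyz.
    by have := xD (y, z); apply => //; apply/allpairsP; exists (y, z).
  - move=> _ /mapP[y yY ->]; have [z Uz <-] := xV y yY.
    by have [_ _ -> //] := Ue y.
  - move=> y yx fy; have [z zY Uz] := xK y (closure_supp fy) yx.
    by apply/mapP; exists z => //; rewrite -yx; have [_ _ -> //] := Ue z.
have Sx0 : S x0 = gconv X f g x0 by exact: nbhs_singleton nearS.
rewrite /continuous_at -Sx0; apply: (@cvg_trans _ (S @ x0)).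
  by apply: near_eq_cvg; exact: nearS.
apply: cvg_sum_seq => y yY.
have yx : grng X y = u0 := Y0P y yY.
have e0 : e y u0 = y.
  by have [Uy _ eK _] := Ue y; rewrite -yx eK//; exact: nbhs_singleton.
apply: cvgM.
  apply: (@cvg_comp _ _ _ (e y \o grng X) f _ (nbhs y)); first exact: ec.
  by rewrite -/u0 e0; exact: fc.
apply: (@cvg_comp _ _ _ _ g _
  (nbhs (gmul X (ginv X (e y (grng X x0))) x0))); last exact: gc.
rewrite -/u0 e0.
have [mc _] := Q_groupoid; move/subspace_continuousP : mc => /(_ (ginv X y, x0)).
rewrite /= gsrcV => /(_ yx) mc.
apply: (@cvg_comp _ _ _ (fun x => (ginv X (e y (grng X x)), x))
  (fun p => gmul X p.1 p.2) _ _ _ _ mc).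
have pc : (fun x => (ginv X (e y (grng X x)), x)) @ x0 --> (ginv X y, x0).
  apply: cvg_pair; last exact: cvg_id.
  apply: (@cvg_comp _ _ _ (e y \o grng X) (ginv X) _ (nbhs y)).
    exact: ec.
  exact: continuous_ginv.
(* Multiplication is continuous only within composable pairs; for [x] near [x0] the section value
   has the same range as [x], so the pair stays composable. *)
move=> A; rewrite /within/= => hA.
have h : \forall x \near x0, gsrc X (ginv X (e y (grng X x))) = grng X x ->
    A (ginv X (e y (grng X x)), x) by exact: (pc _ hA).
apply: filterS2 h nearV => x xA xU; apply: xA.
have [z Uz <-] := xU y yY; have [_ _ eK _] := Ue y.
by rewrite eK// gsrcV.
Qed.

(** The support lies in the set of products of composable pairs from the two supports, which is
    compact because composability is a closed condition. *)
Lemma gconv_Cc f g : Cc f -> Cc g -> Cc (gconv X f g).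
Proof.
move=> fC gC; split; first by apply: gconv_continuous => //; case: gC.
have [[_ fs] [_ gs]] := (fC, gC).
pose K := closure [set x | f x != 0]; pose L := closure [set x | g x != 0].
pose comp := [set p : Q * Q | gsrc X p.1 = grng X p.2].
have compC : closed comp.
  apply: closed_eq_fun => //.
    move=> p; apply: continuous_comp; first exact: cvg_fst.
    exact: continuous_gsrc.
  move=> p; apply: continuous_comp; first exact: cvg_snd.
  exact: continuous_grng.
have KLc : compact ((K `*` L) `&` comp).
  by apply: compact_closedI => //; exact: compact_setX.
apply: (@compactly_supported_sub _ _ _
    ((fun p => gmul X p.1 p.2) @` ((K `*` L) `&` comp))) => //.
  apply: continuous_compact => //.
  by apply: continuous_subspaceW (Q_groupoid.1) => p [].
move=> x /gconv_neq0[y [yx fy gy]].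
exists (y, gmul X (ginv X y) x); last by rewrite /= gmulKV.
by split; [split; exact: closure_supp | rewrite /comp/= grngVM].
Qed.

Lemma fstar_Cc f : Cc f -> Cc (fstar X f).
Proof.
move=> [fc fs]; split.
  move=> x; apply: (@cvg_comp _ _ _ (f \o ginv X)); last exact: continuous_conjc.
  apply: (@cvg_comp _ _ _ (ginv X) f _ (nbhs (ginv X x))); last exact: fc.
  exact: continuous_ginv.
apply: (@compactly_supported_sub _ _ _ (ginv X @` closure [set x | f x != 0])) => //.
  apply: continuous_compact => //; apply: continuous_subspaceT.
  exact: continuous_ginv.
move=> x; rewrite /fstar conjc_eq0 => fx; exists (ginv X x); last exact: ginvK.
exact: closure_supp.
Qed.

End Etale.

(** * Skew products *)

Lemma mulVg_eq (G : groupType) (g p r : G) :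
  ((g^-1 * p)%g == r) = (g == (p * r^-1)%g).
Proof.
apply/eqP/eqP => [<-|->]; first by rewrite invgM invgK mulgA mulgV mul1g.
by rewrite invgM invgK -mulgA mulVg mulg1.
Qed.

Lemma hausdorff_prod (T Y : topologicalType) :
  hausdorff_space T -> hausdorff_space Y -> hausdorff_space (T * Y)%type.
Proof.
move=> hT hY [a b] [a' b'] ab; congr (_, _).
  apply: hT => A B aA aB.
  have [||[x y] [/= Ax Bx]] := ab (A `*` setT) (B `*` setT).
  - by exists (A, setT) => //=; split => //; exact: filterT.
  - by exists (B, setT) => //=; split => //; exact: filterT.
  - by exists x; split; [case: Ax | case: Bx].
apply: hY => A B aA aB.
have [||[x y] [/= Ax Bx]] := ab (setT `*` A) (setT `*` B).
- by exists (setT, A) => //=; split => //; exact: filterT.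
- by exists (setT, B) => //=; split => //; exact: filterT.
- by exists y; split; [case: Ax | case: Bx].
Qed.

Section Skew.
Variables (R : realType) (Q : topologicalType) (X : groupoid Q).
Hypothesis Q_hausdorff : hausdorff_space Q.
Variables (G : groupType) (c : Q -> discrete_topology G).
Hypothesis c_continuous : continuous c.
Hypothesis c_hom : groupoid_hom X (c : Q -> G).
Implicit Types (f h : Q -> R[i]^o) (p g : G).

Local Notation QG := (Q * discrete_topology G)%type.
Local Notation S := (skew_product c_hom).

Let cc : Q -> G := c.

Lemma cocycle_rng x : cc (grng X x) = 1%g.
Proof.
have h : gsrc X (grng X x) = grng X (grng X x) by rewrite gsrc_rng grng_rng.
have := c_hom h; rewrite -{1}(grng_rng X x) gmul_rng => /esym e.
by apply: (mulgI (cc (grng X x))); rewrite mulg1.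
Qed.

Lemma cocycle_inv x : cc (ginv X x) = (cc x)^-1%g.
Proof.
apply: (mulgI (cc x)); rewrite mulgV -(cocycle_rng x) -(gmulV X x) /cc c_hom//.
by rewrite grngV.
Qed.

Lemma cocycle_invM x y : grng X y = grng X x ->
  cc (gmul X (ginv X y) x) = ((cc y)^-1 * cc x)%g.
Proof. by move=> yx; rewrite -cocycle_inv /cc c_hom// gsrcV. Qed.

(** The pair [(p, g)] fixes the matrix position of the arrow: row [p], the second coordinate of its
    range, and column [g^-1 p], that of its source. *)
Definition degree (z : QG) : discrete_topology (G * G)%type :=
  ((cc z.1 * (z.2 : G))%g, cc z.1).

Definition target (z : QG) : discrete_topology G := (cc z.1 * (z.2 : G))%g.

Lemma near_cocycle (z : QG) : \forall w \near z, c w.1 = c z.1 /\ w.2 = z.2.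
Proof.
have h1 : \forall w \near z, c w.1 = c z.1.
  apply: (@cvg_fst _ _ (nbhs z.1) (nbhs z.2)) (c @^-1` [set c z.1]) _.
  exact: (@c_continuous z.1 _ (discrete_set1 _)).
have h2 : \forall w \near z, w.2 = z.2.
  apply: (@cvg_snd _ _ (nbhs z.1) (nbhs z.2)) [set z.2] _.
  exact: discrete_set1.
by apply: filterS2 h1 h2.
Qed.

Lemma degree_continuous : continuous degree.
Proof.
move=> z; apply/discrete_cvg; apply: filterS (near_cocycle z) => w [e1 e2].
by rewrite /degree /cc /= e1 e2.
Qed.

Lemma target_continuous : continuous target.
Proof.
move=> z; apply/discrete_cvg; apply: filterS (near_cocycle z) => w [e1 e2].
by rewrite /target /cc /= e1 e2.
Qed.

(* [emb p f] stands for the sum over [g] of the entries [f_g (x) e_{p, g^-1 p}],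
   [f_g] being the restriction of [f] to [c = g]. *)
Definition emb (p : G) f : QG -> R[i]^o := hpart target p (f \o fst).

Lemma embE p f z : emb p f z = if (cc z.1 * (z.2 : G))%g == p then f z.1 else 0.
Proof. by []. Qed.

Definition slice (t : G) (F : QG -> R[i]^o) : Q -> R[i]^o := fun x => F (x, t).

Lemma slice_continuous t (F : QG -> R[i]^o) : continuous F -> continuous (slice t F).
Proof.
move=> Fc x; apply: (@cvg_comp _ _ _ (fun x : Q => (x, t : discrete_topology G)) F _
    (nbhs (x, t : discrete_topology G))).
  by apply: (@cvg_pair _ _ _ _ (nbhs x) (nbhs (t : discrete_topology G)));
    [exact: cvg_id | exact: cvg_cst].
exact: Fc.
Qed.

Lemma slice_Cc t (F : QG -> R[i]^o) : Cc F -> Cc (slice t F).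
Proof.
move=> [Fc Fs]; split; first exact: slice_continuous.
apply: (@compactly_supported_sub _ _ _ (fst @` closure [set z | F z != 0])) => //.
  by apply: continuous_compact => //; apply: continuous_subspaceT => z; exact: cvg_fst.
by move=> x Fx; exists (x, t) => //; exact: closure_supp.
Qed.

Lemma emb_Cc p f : Cc f -> Cc (emb p f).
Proof.
move=> [fc fs]; split.
  apply: hpart_continuous; first exact: target_continuous.
  by move=> z; apply: continuous_comp; [exact: cvg_fst | exact: fc].
(* The continuous section whose image is the set where [target] equals [p]; it carries the compact
   support of [f] onto a compact set containing that of [emb p f]. *)
pose sec x : QG := (x, ((cc x)^-1 * p)%g).
have secc : continuous sec.
  move=> x; apply: (@cvg_pair _ _ _ _ (nbhs x)
    (nbhs (((cc x)^-1 * p)%g : discrete_topology G))); first exact: cvg_id.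
  have h : \forall y \near x, c y = c x by exact: (c_continuous (discrete_set1 (c x))).
  by apply/discrete_cvg; apply: filterS h => y yx; rewrite /cc /= yx.
apply: (@compactly_supported_sub _ _ _ (sec @` closure [set z | f z != 0])).
- by apply: hausdorff_prod => //; exact: discrete_hausdorff.
- by apply: continuous_compact => //; exact: continuous_subspaceT.
- move=> [x t]; rewrite embE/=; case: ifP => [/eqP xt fx|]; last by rewrite eqxx.
  by exists x; [exact: closure_supp | rewrite /sec -xt mulKg].
Qed.

Lemma embZD p (a : R[i]) f h : emb p (a *: f + h) = a *: emb p f + emb p h.
Proof. by rewrite /emb -hpartZD. Qed.

(** Translation moves row [p] to [p s^-1] and, the degree [g] being unchanged, column [g^-1 p] to
    [g^-1 p s^-1]: both indices are multiplied by [s^-1] on the right. *)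
Lemma emb_shift p f s :
  (fun z : QG => emb p f (z.1, ((z.2 : G) * s)%g)) = emb (p * s^-1)%g f.
Proof.
apply/funext => -[x t]; rewrite !embE/= mulgA.
by congr (if _ then _ else _); rewrite -divg_eq invgK.
Qed.

Lemma emb_degree p g f : homog c g f -> homog degree (p, g) (emb p f).
Proof.
move=> fg [x t]; rewrite embE/=; case: ifP => [/eqP xt fx|]; last by rewrite eqxx.
by rewrite /degree/= xt /cc fg.
Qed.

Lemma degree_emb p g (F : QG -> R[i]^o) : homog degree (p, g) F ->
  homog c g (slice (g^-1 * p)%g F) /\ F = emb p (slice (g^-1 * p)%g F).
Proof.
move=> Fg; split; first by move=> x /Fg [_ e]; exact: e.
apply/funext => -[x t]; rewrite embE /slice/=; case: ifP => [/eqP xt|xt].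
  have [cg|cg] := eqVneq (cc x) g; first by rewrite -xt -cg mulKg.
  have F0 t' : F (x, t') = 0.
    by apply/eqP; apply: contraNT cg => /Fg [_ ->].
  by rewrite !F0.
by apply/eqP; apply: contraFT xt => /Fg [-> _].
Qed.

Lemma skew_fibre_finite (F : QG -> R[i]^o) :
  (forall K : set Q, compact K -> forall u, finite_set [set y | gfiber X u y /\ K y]) ->
  Cc F -> fibre_finite S F.
Proof.
move=> ff [_ Fs] [u t0].
have cK : compact (fst @` closure [set z | F z != 0]).
  by apply: continuous_compact => //; apply: continuous_subspaceT => z; exact: cvg_fst.
apply: (sub_finite_set _ (finite_image (fun y => (y, ((cc y)^-1 * t0)%g) : QG) (ff _ cK u))).
move=> [y t] /= [[yu yt] Fy]; exists y; last by rewrite -yt mulKg.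
by split => //; exists (y, t) => //; exact: closure_supp.
Qed.

Lemma emb_conv p r g f h : fibre_finite X f -> homog c g f ->
  gconv S (emb p f) (emb r h) =
  if g == (p * r^-1)%g then emb p (gconv X f h) else 0.
Proof.
move=> ff fg; apply/funext => -[x t].
have [s [us sx fs]] := fibre_finite_seq (grng X x) ff.
(* An arrow of the skew product with given range is determined by its first coordinate, so [lft]
   lists the fibre over the range of [(x, t)] by the fibre over the range of [x]. *)
pose lft (y : Q) : QG := (y, ((cc y)^-1 * (cc x * (t : G)))%g).
rewrite (@gconv_seq _ _ _ _ _ _ (map lft s)); first last.
- move=> [y t'] [yx yt] Fy; apply/mapP; exists y; last by rewrite /lft -yt mulKg.
  apply: fs => //; move: Fy; rewrite embE/=; case: ifP => // _.
  by rewrite eqxx.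
- by move=> _ /mapP[y ys ->]; congr (_, _); [exact: sx | rewrite mulVKg].
- by rewrite map_inj_uniq// => y z [].
rewrite big_map.
have -> : (if g == (p * r^-1)%g then emb p (gconv X f h) else 0) (x, t) =
    if (cc x * (t : G))%g == p then
      if g == (p * r^-1)%g then gconv X f h x else 0 else 0.
  by case: ifP => _; rewrite ?embE//; case: ifP.
have [xt|xt] := eqVneq (cc x * (t : G))%g p; last first.
  by rewrite big1// => y _; rewrite embE/= mulVKg (negPf xt) mul0r.
have -> : (if g == (p * r^-1)%g then gconv X f h x else 0) =
    \sum_(y <- s) if g == (p * r^-1)%g then f y * h (gmul X (ginv X y) x) else 0.
  by case: ifP => _; [rewrite (gconv_seq h us sx fs) | rewrite big1].
rewrite !big_seq; apply: eq_bigr => y ys.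
rewrite embE/= mulVKg xt eqxx.
have [->|fy] := eqVneq (f y) 0; first by rewrite !mul0r; case: ifP.
rewrite embE/= cocycle_invM ?sx// -mulgA xt.
rewrite [cc y](fg _ fy).
rewrite mulVg_eq.
by case: ifP => // _; rewrite mulr0.
Qed.

Lemma emb_star p g f : homog c g f ->
  fstar S (emb p f) = emb (g^-1 * p)%g (fstar X f).
Proof.
move=> fg; apply/funext => -[x t]; rewrite /fstar !embE/=.
rewrite cocycle_inv mulKg.
have [->|fx] := eqVneq (f (ginv X x)) 0; first by rewrite conjc0 !if_same conjc0.
have cx : cc x = g^-1%g by rewrite -(fg _ fx) -/(cc _) cocycle_inv invgK.
rewrite cx (inj_eq (mulgI _)); case: ifP => // _.
exact: conjc0.
Qed.

Lemma gconv_homog g g' f h : homog c g f -> homog c g' h ->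
  homog c (g * g')%g (gconv X f h).
Proof.
move=> fg hg x /gconv_neq0 [y [yx /fg cy /hg cz]].
move: cz; rewrite -[LHS]/(cc _) cocycle_invM// /cc cy => <-.
by rewrite mulVKg.
Qed.

Lemma fstar_homog g f : homog c g f -> homog c g^-1%g (fstar X f).
Proof.
move=> fg x; rewrite /fstar conjc_eq0 => /fg <-.
by rewrite -[RHS]/((cc (ginv X x))^-1)%g cocycle_inv invgK.
Qed.

End Skew.

(** * Compact operators on l^2(G) *)

Section Ell2Basics.
Variables (R : realType) (G : choiceType).
Implicit Types x y : ell2 R G.

Lemma ell2_normE x : nrm x = ell2_norm x.
Proof. by []. Qed.

Lemma sqr_nrm_ell2 x : (nrm x ^+ 2)%:E = sqsum x.
Proof.
have x2 : (sqsum x < +oo)%E by have := ell2_fun_subproof x; rewrite inE.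
rewrite ell2_normE /ell2_norm sqr_sqrtr ?fine_ge0 ?sqsum_ge0// fineK//.
by rewrite ge0_fin_numE ?sqsum_ge0.
Qed.

Lemma ell2_ext x y : (forall s, x s = y s) -> x = y.
Proof. by move=> xy; apply/val_inj/funext => s; exact: xy. Qed.

Lemma ell2_addE x y s : (x + y) s = x s + y s.
Proof. by []. Qed.

Lemma ell2_scaleE (a : R[i]) x s : (a *: x) s = a * x s.
Proof. by []. Qed.

Lemma ell2_oppE x s : (- x) s = - x s.
Proof. by []. Qed.

Lemma ell2_sumE I (r : seq I) (F : I -> ell2 R G) s :
  (\sum_(i <- r) F i) s = \sum_(i <- r) F i s.
Proof. by elim: r => [|i r ih]; rewrite ?big_nil// !big_cons ell2_addE ih. Qed.

Lemma le_nrm_ell2 x y : (forall s, normc (x s) <= normc (y s)) -> nrm x <= nrm y.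
Proof.
move=> xy; rewrite -(@ler_pXn2r _ 2) ?nnegrE ?nrm_ge0// -lee_fin !sqr_nrm_ell2.
by apply: le_esum => s _; rewrite lee_fin ler_pXn2r ?nnegrE ?normc_ge0.
Qed.

Lemma normc_coord_le x s : normc (x s) <= nrm x.
Proof.
rewrite -(@ler_pXn2r _ 2) ?nnegrE ?nrm_ge0 ?normc_ge0// -lee_fin sqr_nrm_ell2.
apply: esum_ge; exists [set s]; first by split => //; exact: finite_set1.
by rewrite fsbig_set1.
Qed.

Lemma delta_subproof (p : G) :
  (fun s => (s == p)%:R : R[i]^o) \in @ell2_pred R G.
Proof.
rewrite inE/= /sqsum (esumID [set p])//=; last by move=> *; rewrite lee_fin sqr_ge0.
rewrite setTI esum_set1 ?lee_fin ?sqr_ge0// esum1 ?adde0 ?ltry//.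
by move=> s /= [_ /eqP/negPf ->]; rewrite Normc.normc0 expr0n.
Qed.

Definition delta (p : G) : ell2 R G := Ell2 (delta_subproof p).

Lemma deltaE p s : delta p s = (s == p)%:R.
Proof. by []. Qed.

Definition truncate (F : seq G) x : ell2 R G := \sum_(p <- F) x p *: delta p.

Lemma truncateE (F : seq G) x s : uniq F ->
  truncate F x s = if s \in F then x s else 0.
Proof.
move=> uF; rewrite /truncate ell2_sumE; case: ifP => [sF|sF].
  rewrite (bigD1_seq s)// ell2_scaleE deltaE eqxx mulr1 big1 => [|p ps]; first exact: addr0.
  by rewrite ell2_scaleE deltaE eq_sym (negPf ps) mulr0.
rewrite big1_seq// => p /andP[_ pF]; rewrite ell2_scaleE deltaE.
by case: eqP => [sp|_]; [rewrite sp pF in sF | rewrite mulr0].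
Qed.

Lemma truncate_tailE (F : seq G) x s : uniq F ->
  (x - truncate F x) s = if s \in F then 0 else x s.
Proof.
by move=> uF; rewrite ell2_addE ell2_oppE truncateE//; case: ifP; rewrite ?subrr ?subr0.
Qed.

Lemma truncate_tail_le (F : seq G) x : uniq F -> nrm (x - truncate F x) <= nrm x.
Proof.
move=> uF; apply: le_nrm_ell2 => s; rewrite truncate_tailE//.
by case: ifP => // _; rewrite Normc.normc0 normc_ge0.
Qed.

(** The estimate holds for every larger list, so that finitely many vectors can later be truncated
    by a common one. *)
Lemma truncate_cvg x (e : R) : 0 < e -> exists F : seq G, uniq F /\
  forall F' : seq G, uniq F' -> {subset F <= F'} -> nrm (x - truncate F' x) < e.
Proof.
move=> e0; pose a s := (normc (x s) ^+ 2)%:E.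
have a0 s : (0 <= a s)%E by rewrite lee_fin sqr_ge0.
have fin : ereal_sup [set \sum_(i \in A) a i | A in fsets [set: G]]%E \is a fin_num.
  by rewrite -[X in X \is a _]/(sqsum x) -sqr_nrm_ell2.
have e2 : 0 < e ^+ 2 by rewrite exprn_gt0.
have [_ [A [fA _] <-]] := ub_ereal_sup_adherent e2 fin.
rewrite -[ereal_sup _]/(sqsum x) => lA.
pose F := enum_fset (fset_set A).
have FA s : (s \in F) = (s \in A) by rewrite in_fset_set.
exists F; split; first exact: fset_uniq.
move=> F' uF' FF'.
rewrite -(@ltr_pXn2r _ 2) ?nnegrE ?nrm_ge0 ?(ltW e0)// -lte_fin sqr_nrm_ell2.
have Asum : (\sum_(i \in A) a i = \esum_(i in A) a i)%E by rewrite esum_fset.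
have tail : (sqsum (x - truncate F' x)%R <= \esum_(i in ~` A) a i)%E.
  rewrite /sqsum [leRHS]esum_mkcond; apply: le_esum => s _.
  rewrite truncate_tailE//; case: ifP => sF.
    by rewrite Normc.normc0 expr0n; case: ifP.
  case: ifP => // sA; exfalso; move/negP: sA; apply.
  rewrite inE => As; move: sF; rewrite FF'// FA.
  by rewrite mem_set.
apply: (le_lt_trans tail).
have split : sqsum x = (\esum_(i in A) a i + \esum_(i in ~` A) a i)%E.
  rewrite /sqsum (@esumID _ _ A [set: G]); first by rewrite !setTI.
  by move=> s _; exact: a0.
move: lA; rewrite Asum split.
have fx : (\esum_(i in A) a i + \esum_(i in ~` A) a i)%E \is a fin_num.
  by rewrite -split -sqr_nrm_ell2.
move: fx; rewrite fin_numD => /andP[].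
set u := (\esum_(i in A) a i)%E; set v := (\esum_(i in ~` A) a i)%E.
case: u => [u| |]//; case: v => [v| |]// _ _.
by rewrite -EFinD -EFinB !lte_fin; lra.
Qed.

(** The net of partial sums is constant once the index set contains [p]. *)
Lemma ell2_inner_delta_l (a : R[i]) p y : ell2_inner (a *: delta p) y = a * (y p)^*%C.
Proof.
rewrite /ell2_inner /summability.sum.
apply: (@lim_near_cst R[i]^o (@norm_hausdorff _ _) _ _ (@summability.totally_filter G)).
exists (fset1 p) => // A pA.
rewrite /summability.partial_sum.
have {}pA : p \in A by apply: (fsubsetP pA); rewrite in_fset1.
rewrite (bigD1 (FSetSub pA))//= big1 ?addr0.
  by rewrite -[LHS]/(a * (p == p)%:R * (y p)^*%C) eqxx mulr1.
move=> [q qA] qp; rewrite -[LHS]/(a * (q == p)%:R * (y q)^*%C).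
have -> : (q == p) = false by apply: negbTE; apply: contra_neq qp => qp; apply: val_inj.
by rewrite mulr0 mul0r.
Qed.

Lemma ell2_inner_delta_r x s : ell2_inner (delta s) x = (x s)^*%C.
Proof. by rewrite -[delta s]scale1r ell2_inner_delta_l mul1r. Qed.

Definition elementary (p q : G) x : ell2 R G := x q *: delta p.

Lemma nrm_delta p : nrm (delta p) <= 1.
Proof.
rewrite -(@ler_pXn2r _ 2) ?nnegrE ?nrm_ge0// -lee_fin sqr_nrm_ell2.
rewrite /sqsum (esumID [set p])//=; last by move=> *; rewrite lee_fin sqr_ge0.
rewrite setTI esum_set1 ?lee_fin ?sqr_ge0// esum1 ?adde0.
  by rewrite eqxx Normc.normc1.
by move=> s /= [_ /eqP/negPf ->]; rewrite Normc.normc0 expr0n.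
Qed.

(** The unit ball has its coordinate at [q] in the unit disc, so its image lies in the continuous
    image of the compact square of pairs of real and imaginary parts. *)
Lemma elementary_compact p q : compact_operator (elementary p q).
Proof.
split; first by move=> a x y; rewrite /elementary ell2_addE ell2_scaleE scalerDl scalerA.
pose f (z : R * R) : ell2 R G := (z.1 +i* z.2) *: delta p.
have fc : continuous f.
  move=> z A /nbhs_ballP[d /= d0 dA].
  have dr : d = (complex.Re d)%:C by rewrite RRe_real// gtr0_real.
  have r0 : 0 < complex.Re d by rewrite -ltcR -dr.
  have r2 : 0 < complex.Re d / 2 by rewrite divr_gt0.
  have h1 : \forall w \near z, `|z.1 - w.1| < complex.Re d / 2.
    apply: (@cvg_fst _ _ (nbhs z.1) (nbhs z.2)) [set u | `|z.1 - u| < complex.Re d / 2] _.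
    by apply/nbhs_ballP; exists (complex.Re d / 2).
  have h2 : \forall w \near z, `|z.2 - w.2| < complex.Re d / 2.
    apply: (@cvg_snd _ _ (nbhs z.1) (nbhs z.2)) [set u | `|z.2 - u| < complex.Re d / 2] _.
    by apply/nbhs_ballP; exists (complex.Re d / 2).
  apply: filterS2 h1 h2 => w w1 w2; apply: dA; rewrite dr nrm_ballE /=.
  rewrite /f -scalerBl nrmZ.
  have le : normc ((z.1 +i* z.2) - (w.1 +i* w.2)) <= `|z.1 - w.1| + `|z.2 - w.2|.
    have -> : (z.1 +i* z.2) - (w.1 +i* w.2) =
        ((z.1 - w.1) +i* 0) + (0 +i* (z.2 - w.2)) :> R[i].
      by apply/eqP; rewrite eq_complex/= addr0 add0r !eqxx.
    apply: (le_trans (le_normcD _ _)).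
    by rewrite /= !expr0n addr0 add0r !sqrtr_sqr.
  have := ler_pM (normc_ge0 _) (nrm_ge0 _) le (nrm_delta p).
  lra.
have cI : compact (f @` (`[-1, 1] `*` `[-1, 1])).
  apply: continuous_compact; first exact: continuous_subspaceT.
  by apply: compact_setX; exact: segment_compact.
apply: (@precompact_subset _ _ (f @` (`[-1, 1] `*` `[-1, 1]))).
  move=> _ [x /= x1 <-]; have {}x1 : normc (x q) <= 1.
    apply: (le_trans (normc_coord_le _ _)).
    by move: x1; rewrite nrmE -[X in _ <= X]/(1%:C) lecR.
  exists (complex.Re (x q), complex.Im (x q)); last first.
    by rewrite /f /elementary; case: (x q : R[i]).
  case: (x q : R[i]) x1 => u v /= uv.
  have sq1 : u ^+ 2 + v ^+ 2 <= 1.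
    have := ler_pM (sqrtr_ge0 _) (sqrtr_ge0 _) uv uv.
    by rewrite -expr2 sqr_sqrtr ?mulr1// addr_ge0// sqr_ge0.
  have key (s t : R) : s ^+ 2 + t ^+ 2 <= 1 -> -1 <= s <= 1.
    move=> st; rewrite -ler_norml -(@ler_pXn2r _ 2) ?nnegrE ?normr_ge0// expr1n.
    by rewrite real_normK ?num_real// (le_trans _ st)// lerDl sqr_ge0.
  split; rewrite /= in_itv/=; first exact: key sq1.
  by apply: (key v u); rewrite addrC.
apply: compact_precompact => //; exact: norm_hausdorff.
Qed.

End Ell2Basics.

Section CompactOperators.
Variables (R : realType) (G : choiceType) (K : cstarAlgType R).
Variable rho : K -> ell2 R G -> ell2 R G.
Hypothesis K_compact : is_compact_operators rho.

Lemma rhoZD (a : R[i]) k l x : rho (a *: k + l) x = a *: rho k x + rho l x.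
Proof. by case: K_compact. Qed.

Lemma rhoM k l x : rho (cmul k l) x = rho k (rho l x).
Proof. by case: K_compact. Qed.

Lemma rho_adjoint k x y : ell2_inner (rho k x) y = ell2_inner x (rho (cstar k) y).
Proof. by case: K_compact. Qed.

Lemma rho_least k (M : R) : 0 <= M -> (forall x, nrm (rho k x) <= M * nrm x) ->
  nrm k <= M.
Proof.
move=> M0 kM; have [_ _ _ _ /(_ k) [_ /(_ M%:C) h]] := K_compact.
rewrite -lecR -nrmE; apply: h => [|x]; first by rewrite ler0c.
by rewrite !nrmE -rmorphM/= lecR.
Qed.

Lemma rho_compact k : compact_operator (rho k).
Proof. by case: K_compact => /(_ (rho k)) [_ h] _ _ _ _; apply: h; exists k. Qed.

Lemma rho_linear k (a : R[i]) x y : rho k (a *: x + y) = a *: rho k x + rho k y.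
Proof. by case: (rho_compact k) => h _; exact: (h a x y). Qed.

Lemma rhoD k l x : rho (k + l) x = rho k x + rho l x.
Proof. by have := rhoZD 1 k l x; rewrite !scale1r. Qed.

Lemma rho0 x : rho 0 x = 0.
Proof. by have := rhoZD (-1) 0 0 x; rewrite scaler0 addr0 scaleN1r addNr. Qed.

Lemma rhoB k l x : rho (k - l) x = rho k x - rho l x.
Proof. by have := rhoZD (-1) l k x; rewrite !scaleN1r ![- _ + _]addrC. Qed.

Lemma rho_sum I (r : seq I) (F : I -> K) x :
  rho (\sum_(i <- r) F i) x = \sum_(i <- r) rho (F i) x.
Proof. by elim: r => [|i r ih]; rewrite ?big_nil ?rho0// !big_cons rhoD ih. Qed.

Lemma rho_vec0 k : rho k 0 = 0.
Proof. by have := rho_linear k (-1) 0 0; rewrite scaler0 addr0 scaleN1r addNr. Qed.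

Lemma rho_scale k (a : R[i]) x : rho k (a *: x) = a *: rho k x.
Proof. by have := rho_linear k a x 0; rewrite rho_vec0 !addr0. Qed.

Lemma rho_inj k l : (forall x, rho k x = rho l x) -> k = l.
Proof.
move=> kl; apply/eqP; rewrite -subr_eq0; apply/eqP/nrm0_eq0/eqP.
rewrite eq_le nrm_ge0 andbT; apply: rho_least => // x.
by rewrite rhoB kl subrr nrm0 mul0r.
Qed.

Lemma matrix_units_exist : exists E : G -> G -> K,
  forall p q x, rho (E p q) x = x q *: delta R p.
Proof.
have : forall pq : G * G, exists k, forall x, rho k x = x pq.2 *: delta R pq.1.
  move=> [p q]; have [/(_ (@elementary R G p q)) [h _] _ _ _ _] := K_compact.
  have [k rk] := h (elementary_compact _ p q).
  by exists k => x; rewrite rk.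
by move=> /choice[E EP]; exists (fun p q => E (p, q)) => p q x; rewrite EP.
Qed.

Section Units.
Variable E : G -> G -> K.
Hypothesis EE : forall p q x, rho (E p q) x = x q *: delta R p.

Lemma unit_mul p q r s : cmul (E p q) (E r s) = if q == r then E p s else 0.
Proof.
apply: rho_inj => x; rewrite rhoM !EE ell2_scaleE deltaE.
by case: ifP => _; rewrite ?EE ?mulr1// mulr0 scale0r rho0.
Qed.

Lemma unit_star p q : cstar (E p q) = E q p.
Proof.
apply: rho_inj => y; apply: ell2_ext => s.
have := rho_adjoint (E p q) (delta R s) y.
rewrite EE deltaE ell2_inner_delta_l ell2_inner_delta_r EE ell2_scaleE deltaE.
move=> /(congr1 (@conjc R)); rewrite conjcK => <-.
by rewrite rmorphM/= conjcK mulrC eq_sym rmorph_nat.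
Qed.

Lemma unit_nrm p q : nrm (E p q) = 1.
Proof.
have diag r : nrm (E r r) = 1.
  have n0 : nrm (E r r) != 0.
    apply/eqP => /nrm0_eq0 Er; have := EE r r (delta R r); rewrite Er rho0.
    move=> /(congr1 (fun x : ell2 R G => x r)); rewrite ell2_scaleE deltaE eqxx mulr1.
    by move=> /eqP; rewrite eq_sym oner_eq0.
  apply: (mulfI n0); rewrite mulr1 -expr2 -nrm_star_mul unit_star unit_mul.
  by rewrite eqxx.
apply/eqP; rewrite -(@eqrXn2 _ 2) ?nrm_ge0// expr1n -nrm_star_mul unit_star unit_mul.
by rewrite eqxx diag.
Qed.

Definition diag_proj (F : seq G) : K := \sum_(p <- F) E p p.

Lemma rho_diag_proj F x : rho (diag_proj F) x = truncate F x.
Proof. by rewrite /diag_proj rho_sum; apply: eq_bigr => p _; rewrite EE. Qed.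

(** The image of the unit ball under a compact operator has a finite [e / 2]-net, and a truncation
    good for all points of the net is good on the whole image. *)
Lemma diag_proj_left k (e : R) : 0 < e -> exists F : seq G, uniq F /\
  forall F' : seq G, uniq F' -> {subset F <= F'} ->
  nrm (k - cmul (diag_proj F') k) <= e.
Proof.
move=> e0; have e2 : 0 < e / 2 by rewrite divr_gt0.
have [_] := rho_compact k; rewrite precompactE => cK.
have [|s scov] := compact_finite_nbhs cK (f := fun y => ball y (e / 2)%:C).
  by move=> y _; apply: nbhsx_ballx; rewrite ltcR.
have /choice[T TP] : forall y : ell2 R G, exists F : seq G, uniq F /\
    forall F' : seq G, uniq F' -> {subset F <= F'} -> nrm (y - truncate F' y) < e / 2.
  by move=> y; exact: truncate_cvg.
pose F := undup (flatten [seq T y | y <- s]).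
exists F; split; first exact: undup_uniq.
move=> F' uF' FF'; apply: rho_least; first exact: ltW.
have unit_ball x : nrm x <= 1 -> nrm (rho (k - cmul (diag_proj F') k) x) <= e.
  move=> x1; have [y ys] : exists2 y, y \in s & ball y (e / 2)%:C (rho k x).
    apply: scov; apply: subset_closure; exists x => //=.
    by rewrite nrmE -[X in _ <= X]/(1%:C) lecR.
  rewrite nrm_ballE /= => yx.
  rewrite rhoB rhoM rho_diag_proj.
  have yt : nrm (y - truncate F' y) < e / 2.
    apply: (TP y).2 => // p pT; apply: FF'; rewrite mem_undup.
    by apply/flattenP; exists (T y) => //; apply: map_f.
  set z := rho k x in yx *.
  (* Cutting off coordinates is linear and taking tails does not increase the norm, so the second
     term is at most [nrm (y - z)]. *)
  have -> : z - truncate F' z = (y - truncate F' y) - ((y - z) - truncate F' (y - z)).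
    apply: ell2_ext => t; rewrite !(ell2_addE, ell2_oppE) !truncateE//.
    rewrite !(ell2_addE, ell2_oppE).
    by case: ifP => _; ring.
  apply: (le_trans (nrmB _ _)).
  have := truncate_tail_le (y - z) uF'; lra.
move=> x; have [x0|xn0] := eqVneq (nrm x) 0.
  by rewrite (nrm0_eq0 x0) rho_vec0 !nrm0 mulr0.
have xp : 0 < nrm x by rewrite lt_neqAle eq_sym xn0 nrm_ge0.
have nx : normc ((nrm x)^-1)%:C = (nrm x)^-1.
  by rewrite /= expr0n addr0 sqrtr_sqr ger0_norm// invr_ge0 ltW.
have := unit_ball (((nrm x)^-1)%:C *: x); rewrite rho_scale !nrmZ nx mulVf//.
by move=> /(_ (lexx _)); rewrite mulrC ler_pdivrMr.
Qed.

Lemma diag_proj_star F : cstar (diag_proj F) = diag_proj F.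
Proof. by rewrite /diag_proj cstar_sum; apply: eq_bigr => p _; rewrite unit_star. Qed.

Lemma diag_proj_nrm F : uniq F -> nrm (diag_proj F) <= 1.
Proof.
move=> uF; have idem : cmul (diag_proj F) (diag_proj F) = diag_proj F.
  apply: rho_inj => x; rewrite rhoM !rho_diag_proj.
  by apply: ell2_ext => s; rewrite !truncateE//; case: (s \in F).
have [->|n0] := eqVneq (nrm (diag_proj F)) 0; first exact: ler01.
have np : 0 < nrm (diag_proj F) by rewrite lt_neqAle eq_sym n0 nrm_ge0.
rewrite -(ler_pM2r np) mul1r -expr2 -nrm_star_mul diag_proj_star idem//.
Qed.

(** Compress [k] from both sides: the right-hand estimate is the left-hand one for [k^*]. The
    compression is a combination of matrix units whose coefficients are the matrix entries of
    [k]. *)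
Lemma matrix_units_dense k (e : R) : 0 < e -> exists (F : seq G) (a : G -> G -> R[i]),
  nrm (k - \sum_(p <- F) \sum_(q <- F) a p q *: E p q) < e.
Proof.
move=> e0; have e3 : 0 < e / 3 by rewrite divr_gt0.
have [F1 [_ F1P]] := diag_proj_left k e3.
have [F2 [_ F2P]] := diag_proj_left (cstar k) e3.
pose F := undup (F1 ++ F2).
have uF : uniq F := undup_uniq _.
have k1 : nrm (k - cmul (diag_proj F) k) <= e / 3.
  by apply: F1P => // p pF; rewrite mem_undup mem_cat pF.
have k2 : nrm (k - cmul k (diag_proj F)) <= e / 3.
  rewrite -nrm_star cstarB cstarM diag_proj_star.
  by apply: F2P => // p pF; rewrite mem_undup mem_cat pF orbT.
exists F, (fun p q => rho k (delta R q) p).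
have -> : \sum_(p <- F) \sum_(q <- F) rho k (delta R q) p *: E p q =
    cmul (cmul (diag_proj F) k) (diag_proj F).
  rewrite /diag_proj !cmul_suml; apply: eq_bigr => p _.
  rewrite cmul_sumr; apply: eq_bigr => q _.
  apply: rho_inj => x; rewrite !rhoM !EE rho_scale.
  have := rhoZD (rho k (delta R q) p) (E p q) 0 x; rewrite addr0 rho0 addr0 => ->.
  by rewrite EE ell2_scaleE !scalerA mulrC.
have -> : k - cmul (cmul (diag_proj F) k) (diag_proj F) =
   (k - cmul k (diag_proj F)) + cmul (k - cmul (diag_proj F) k) (diag_proj F).
  by rewrite cmulBl addrA subrK.
apply: (le_lt_trans (nrmD _ _)).
have := nrm_mul (k - cmul (diag_proj F) k) (diag_proj F).
have := ler_pM (nrm_ge0 _) (nrm_ge0 _) k1 (diag_proj_nrm uF).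
lra.
Qed.

End Units.

End CompactOperators.

(** * Enveloping algebras and crossed products *)

Section GroupoidEnvelope.
Variables (R : realType) (Y : topologicalType) (X : groupoid Y).
Variables (E : cstarAlgType R) (iota : (Y -> R[i]^o) -> E).
Hypothesis E_env : is_groupoid_cstar X iota.
Implicit Types f g : Y -> R[i]^o.

Lemma envZD (a : R[i]) f g : Cc f -> Cc g ->
  iota (a *: f + g) = a *: iota f + iota g.
Proof. by case: E_env => -[h _ _] _ _ fC gC; exact: h. Qed.

Lemma envM f g : Cc f -> Cc g -> iota (gconv X f g) = cmul (iota f) (iota g).
Proof. by case: E_env => -[_ h _] _ _ fC gC; exact: h. Qed.

Lemma envS f : Cc f -> iota (fstar X f) = cstar (iota f).
Proof. by case: E_env => -[_ _ h] _ _ fC; exact: h. Qed.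

Lemma env0 : iota 0 = 0.
Proof.
by have := envZD (-1) (Cc0 R Y) (Cc0 R Y); rewrite scaler0 addr0 scaleN1r addNr.
Qed.

Lemma envD f g : Cc f -> Cc g -> iota (f + g) = iota f + iota g.
Proof. by move=> fC gC; have := envZD 1 fC gC; rewrite !scale1r. Qed.

Lemma env_dense x (e : R) : 0 < e ->
  exists2 s, (exists2 f, Cc f & iota f = s) & nrm (x - s) < e.
Proof.
move=> e0; have [_ dE _] := E_env.
by have [s [f fC fs] xs] := dense_nrm x dE e0; exists s => //; exists f.
Qed.

Lemma env_universal (D : cstarAlgType R) (phi : (Y -> R[i]^o) -> D) :
  (forall (a : R[i]) f g, Cc f -> Cc g -> phi (a *: f + g) = a *: phi f + phi g) ->
  (forall f g, Cc f -> Cc g -> phi (gconv X f g) = cmul (phi f) (phi g)) ->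
  (forall f, Cc f -> phi (fstar X f) = cstar (phi f)) ->
  forall f, Cc f -> nrm (phi f) <= nrm (iota f).
Proof.
move=> pl pm ps f fC; have [_ _ univ] := E_env.
by rewrite -lecR -!nrmE; apply: univ => //; split.
Qed.

(** The norm bound is a hypothesis instead of a consequence of multiplicativity, so the lemma also
    covers off-diagonal corners and translated maps, which are not *-homomorphisms. *)
Lemma env_extension (D : completeNormedModType R[i]) (L : (Y -> R[i]^o) -> D) :
  (forall (a : R[i]) f g, Cc f -> Cc g -> L (a *: f + g) = a *: L f + L g) ->
  (forall f, Cc f -> nrm (L f) <= nrm (iota f)) ->
  exists phi : E -> D, [/\ linear phi, contractive phi &
    forall f, Cc f -> phi (iota f) = L f].
Proof.
move=> Ll Lb.
have [|||phi [pl pc pE]] := @dense_extension _ E D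
    (fun x y => exists2 f, Cc f & x = iota f /\ y = L f).
- move=> a x x' y y' [f fC [-> ->]] [g gC [-> ->]].
  by exists (a *: f + g); [exact: CcZD | rewrite envZD// Ll].
- by move=> x y [f fC [-> ->]]; exact: Lb.
- move=> x e e0; have [s [f fC fs] xs] := env_dense x e0.
  by exists s => //; exists (L f), f.
by exists phi; split => // f fC; apply: pE; exists f.
Qed.

Lemma env_eq (D : completeNormedModType R[i]) (f g : E -> D) :
  bounded_linear f -> bounded_linear g ->
  (forall h, Cc h -> f (iota h) = g (iota h)) -> f =1 g.
Proof.
move=> fb gb fg; apply: (eq_on_dense fb gb (W := [set s | exists2 h, Cc h & iota h = s])).
  by move=> x e; exact: env_dense.
by move=> _ [h hC <-]; exact: fg.
Qed.

End GroupoidEnvelope.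

Section FiniteSums.
Variables (V : nmodType) (I : choiceType).

Lemma fsum_seq (u : I -> V) (s : seq I) : uniq s -> (forall i, i \notin s -> u i = 0) ->
  \sum_(i \in [set: I]) u i = \sum_(i <- s) u i.
Proof.
move=> us su; rewrite (@fsbigE _ _ _ _ _ s _ us)//.
  by apply: eq_bigl => i; rewrite in_setT.
by move=> i _; exact: su.
Qed.

Lemma finite_support_seq (u : I -> V) : finite_set [set i | u i != 0] ->
  exists s : seq I, uniq s /\ forall i, i \notin s -> u i = 0.
Proof.
move=> fu; exists (enum_fset (fset_set [set i | u i != 0])).
split; first exact: fset_uniq.
move=> i; rewrite in_fset_set// => /negP iN; apply/eqP; apply: contrapT => /negP ui.
by apply: iN; rewrite inE.
Qed.

Lemma finite_support_of_seq (u : I -> V) (s : seq I) :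
  (forall i, i \notin s -> u i = 0) -> finite_set [set i | u i != 0].
Proof.
move=> us; apply: (sub_finite_set _ (finite_seq s)) => i /= ui.
by apply: contrapT => /negP /us u0; rewrite u0 eqxx in ui.
Qed.

End FiniteSums.

(** * Crossed products by discrete groups *)

Section CrossedProduct.
Variables (R : realType) (G : groupType) (A : cstarAlgType R).
Variables (beta : G -> A -> A) (P : cstarAlgType R) (iota : (G -> A) -> P).
Hypothesis beta_action : cstar_action beta.
Hypothesis P_crossed : is_crossed_product beta iota.
Implicit Types F H : G -> A.

Definition finsupp F := finite_set [set s | F s != 0].

Definition cross_mul F H : G -> A := fun s =>
  \sum_(t \in [set: G]) cmul (F t) (beta t (H (t^-1 * s)%g)).

Definition cross_star F : G -> A := fun s => beta s (cstar (F s^-1%g)).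

Lemma beta_hom s : cstar_hom (beta s).
Proof. by case: beta_action. Qed.

Lemma beta1 a : beta 1%g a = a.
Proof. by case: beta_action. Qed.

Lemma betaM s t a : beta (s * t)%g a = beta s (beta t a).
Proof. by case: beta_action. Qed.

Lemma beta_linear s : linear (beta s).
Proof. by have [] := cstar_homP (beta_hom s). Qed.

Lemma beta0 s : beta s 0 = 0.
Proof. by have := beta_linear s (-1) 0 0; rewrite scaler0 addr0 scaleN1r addNr. Qed.

Lemma beta_bounded s : bounded_linear (beta s).
Proof.
by apply: contractive_bounded; [exact: beta_linear | exact: cstar_hom_contractive (beta_hom s)].
Qed.

Lemma finsuppZD (a : R[i]) F H : finsupp F -> finsupp H -> finsupp (a *: F + H).
Proof.
move=> /finite_support_seq[s [_ sF]] /finite_support_seq[t [_ tH]].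
apply: (@finite_support_of_seq _ _ _ (s ++ t)) => i; rewrite mem_cat negb_or => /andP[is_ it].
by rewrite !fctE sF// tH// scaler0 addr0.
Qed.

Lemma finsupp_mul F H : finsupp F -> finsupp H -> finsupp (cross_mul F H).
Proof.
move=> /finite_support_seq[s [us sF]] /finite_support_seq[t [_ tH]].
apply: (@finite_support_of_seq _ _ _ [seq (p * q)%g | p <- s, q <- t]) => r rN.
rewrite /cross_mul (fsum_seq us); last by move=> i /sF ->; rewrite cmul0l.
rewrite big1_seq// => p /andP[_ ps]; rewrite tH ?beta0 ?cmul0r//.
apply/negP => qt; move/negP: rN; apply; apply/allpairsP.
by exists (p, (p^-1 * r)%g); split => //=; rewrite mulVKg.
Qed.

Lemma finsupp_star F : finsupp F -> finsupp (cross_star F).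
Proof.
move=> /finite_support_seq[s [us sF]].
apply: (@finite_support_of_seq _ _ _ [seq p^-1%g | p <- s]) => r rN.
rewrite /cross_star sF ?cstar0 ?beta0//; apply/negP => rs; move/negP: rN; apply.
by apply/mapP; exists r^-1%g => //; rewrite invgK.
Qed.

Lemma crossZD (a : R[i]) F H : finsupp F -> finsupp H ->
  iota (a *: F + H) = a *: iota F + iota H.
Proof. by case: P_crossed => -[h _ _] _ _ fC gC; exact: h. Qed.

Lemma crossM F H : finsupp F -> finsupp H ->
  iota (cross_mul F H) = cmul (iota F) (iota H).
Proof. by case: P_crossed => -[_ h _] _ _ fC gC; exact: h. Qed.

Lemma crossS F : finsupp F -> iota (cross_star F) = cstar (iota F).
Proof. by case: P_crossed => -[_ _ h] _ _ fC; exact: h. Qed.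

Lemma cross_dense x (e : R) : 0 < e ->
  exists2 s, (exists2 F, finsupp F & iota F = s) & nrm (x - s) < e.
Proof.
move=> e0; have [_ dE _] := P_crossed.
by have [s [F FS Fs] xs] := dense_nrm x dE e0; exists s => //; exists F.
Qed.

Definition single (s : G) (a : A) : G -> A := fun t => if t == s then a else 0.

(** The element usually written [a u_s]; it lies in the crossed product even when the unitary [u_s]
    lies only in its multiplier algebra. *)
Definition at_group (s : G) (a : A) : P := iota (single s a).

Lemma single_finsupp s a : finsupp (single s a).
Proof.
apply: (@finite_support_of_seq _ _ _ [:: s]) => t; rewrite inE /single.
by move=> /negPf ->.
Qed.

Lemma at_groupZD s (a : R[i]) x y :
  at_group s (a *: x + y) = a *: at_group s x + at_group s y.
Proof.
rewrite /at_group -crossZD//; try exact: single_finsupp.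
congr iota; apply/funext => t; rewrite !fctE /single.
by case: ifP => // _; rewrite scaler0 addr0.
Qed.

Lemma at_group_mul s t a b :
  cmul (at_group s a) (at_group t b) = at_group (s * t)%g (cmul a (beta s b)).
Proof.
rewrite /at_group -crossM; try exact: single_finsupp.
congr iota; apply/funext => v; rewrite /cross_mul (@fsum_seq _ _ _ [:: s])//; last first.
  by move=> u; rewrite inE /single => /negPf ->; rewrite cmul0l.
rewrite big_seq1 /single eqxx.
have -> : ((s^-1 * v)%g == t) = (v == (s * t)%g).
  by apply/eqP/eqP => [<-|->]; rewrite ?mulVKg ?mulKg.
by case: ifP => // _; rewrite beta0 cmul0r.
Qed.

Lemma at_group_star s a : cstar (at_group s a) = at_group s^-1%g (beta s^-1%g (cstar a)).
Proof.
rewrite /at_group -crossS; last exact: single_finsupp.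
congr iota; apply/funext => v; rewrite /cross_star /single.
by rewrite eqg_invLR; case: eqP => [->|_]//; rewrite cstar0 beta0.
Qed.

Lemma at_group1_hom : cstar_hom (at_group 1%g).
Proof.
split; first by move=> a x y _ _; exact: at_groupZD.
  by move=> x y _ _ /=; rewrite at_group_mul mulg1 beta1.
by move=> x _ /=; rewrite at_group_star invg1 beta1.
Qed.

(** The product of [a u_s] with its adjoint is [a a^*] at the identity of the group, where
    [at_group] is a *-homomorphism and hence contractive. *)
Lemma at_group_contractive s : contractive (at_group s).
Proof.
move=> a; rewrite -(@ler_pXn2r _ 2) ?nnegrE ?nrm_ge0// -nrm_mul_star.
rewrite at_group_star at_group_mul mulgV -betaM mulgV beta1.
apply: (le_trans (cstar_hom_contractive at_group1_hom _)).
by rewrite nrm_mul_star.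
Qed.

Lemma at_group_bounded s : bounded_linear (at_group s).
Proof.
apply: contractive_bounded; last exact: at_group_contractive.
by move=> a x y; exact: at_groupZD.
Qed.

Lemma cross_sum F (S : seq G) : uniq S -> (forall s, s \notin S -> F s = 0) ->
  iota F = \sum_(s <- S) at_group s (F s).
Proof.
move=> uS SF.
have FE : F = \sum_(s <- S) single s (F s).
  apply/funext => t; rewrite fct_sumE.
  have [tS|tS] := boolP (t \in S).
    rewrite (bigD1_seq t)//= {1}/single eqxx big1 ?addr0// => s st.
    by rewrite /single eq_sym (negPf st).
  rewrite big1_seq ?SF// => s /andP[_ sS]; rewrite /single.
  by case: eqP => // ts; rewrite ts sS in tS.
have z : iota 0 = 0.
  have f0 : finsupp 0 by exact: (@finite_support_of_seq _ _ _ [::]).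
  by have := crossZD (-1) f0 f0; rewrite scaler0 addr0 scaleN1r addNr.
rewrite {1}FE.
suff [] : finsupp (\sum_(s <- S) single s (F s)) /\
  iota (\sum_(s <- S) single s (F s)) = \sum_(s <- S) at_group s (F s) by [].
elim: (S) => [|s T [ih1 ih2]].
  by rewrite !big_nil; split => //; exact: (@finite_support_of_seq _ _ _ [::]).
rewrite !big_cons; split.
  by rewrite -[single s _]scale1r; apply: finsuppZD => //; exact: single_finsupp.
rewrite -[single s _]scale1r crossZD ?scale1r ?ih2//.
exact: single_finsupp.
Qed.

Lemma cross_eq (D : completeNormedModType R[i]) (f g : P -> D) :
  bounded_linear f -> bounded_linear g ->
  (forall s a, f (at_group s a) = g (at_group s a)) -> f =1 g.
Proof.
move=> fb gb fg; have add (h : P -> D) : bounded_linear h ->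
    forall r F, h (\sum_(s <- r) at_group s (F s)) = \sum_(s <- r) h (at_group s (F s)).
  move=> [hl _] r F.
  have hD x y : h (x + y) = h x + h y by have := hl 1 x y; rewrite !scale1r.
  have h0 : h 0 = 0 by have := hl (-1) 0 0; rewrite scaler0 addr0 scaleN1r addNr.
  exact: (big_morph h).
apply: (eq_on_dense fb gb (W := [set s | exists2 F, finsupp F & iota F = s])).
  by move=> x e; exact: cross_dense.
move=> _ [F /finite_support_seq[S [uS SF]] <-].
by rewrite (cross_sum uS SF) !add//; apply: eq_bigr => s _.
Qed.

(** [phi s a] is the intended image of [a u_s]. The two relations express covariance through these
    products alone, so [D] need not contain unitaries implementing the action. *)
Lemma cross_extension (D : cstarAlgType R) (phi : G -> A -> D) :
  (forall s, linear (phi s)) ->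
  (forall s t a b, cmul (phi s a) (phi t b) = phi (s * t)%g (cmul a (beta s b))) ->
  (forall s a, cstar (phi s a) = phi s^-1%g (beta s^-1%g (cstar a))) ->
  exists Phi : P -> D, [/\ cstar_hom Phi, bounded_linear Phi &
    forall s a, Phi (at_group s a) = phi s a].
Proof.
move=> phil phiM phiS.
have phi0 s : phi s 0 = 0.
  by have := phil s (-1) 0 0; rewrite scaler0 addr0 scaleN1r addNr.
have phiD s a b : phi s (a + b) = phi s a + phi s b.
  by have := phil s 1 a b; rewrite !scale1r.
have phiZ s (k : R[i]) a : phi s (k *: a) = k *: phi s a.
  by have := phil s k a 0; rewrite phi0 !addr0.
pose Psi F : D := \sum_(s \in [set: G]) phi s (F s).
have PsiE F S : uniq S -> (forall s, s \notin S -> F s = 0) ->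
    Psi F = \sum_(s <- S) phi s (F s).
  by move=> uS SF; apply: fsum_seq => // s /SF ->.
have PsiZD (a : R[i]) F H : finsupp F -> finsupp H ->
    Psi (a *: F + H) = a *: Psi F + Psi H.
  move=> /finite_support_seq[s [us sF]] /finite_support_seq[t [ut tH]].
  pose w := undup (s ++ t).
  have uw : uniq w := undup_uniq _.
  have wF i : i \notin w -> F i = 0.
    by rewrite mem_undup mem_cat negb_or => /andP[/sF].
  have wH i : i \notin w -> H i = 0.
    by rewrite mem_undup mem_cat negb_or => /andP[_ /tH].
  rewrite (PsiE F w)// (PsiE H w)// (PsiE _ w)//; last first.
    by move=> i iw; rewrite !fctE wF// wH// scaler0 addr0.
  rewrite scaler_sumr -big_split; apply: eq_bigr => i _.
  by rewrite !fctE phiD phiZ.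
have PsiM F H : finsupp F -> finsupp H -> Psi (cross_mul F H) = cmul (Psi F) (Psi H).
  move=> Ff Hf; have [S [uS SF]] := finite_support_seq Ff.
  have [T [uT TH]] := finite_support_seq Hf.
  have [W [uW WFH]] := finite_support_seq (finsupp_mul Ff Hf).
  rewrite (PsiE _ _ uS SF) cmul_suml.
  (* All products [p q] are included, so that for each fixed [p] the sum over [s] can be reindexed
     by [s = p q]. *)
  pose W' := undup (W ++ [seq (p * q)%g | p <- S, q <- T]).
  have uW' : uniq W' := undup_uniq _.
  rewrite (PsiE _ W' uW'); last first.
    by move=> s; rewrite mem_undup mem_cat negb_or => /andP[/WFH].
  transitivity (\sum_(s <- W') \sum_(p <- S) phi s (cmul (F p) (beta p (H (p^-1 * s)%g)))).
    apply: eq_bigr => s _; rewrite /cross_mul (fsum_seq uS).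
      exact: (big_morph (phi s)).
    by move=> p /SF ->; rewrite cmul0l.
  rewrite exchange_big/= !big_seq; apply: eq_bigr => p pS.
  rewrite -(@fsum_seq _ _ (fun s => phi s (cmul (F p) (beta p (H (p^-1 * s)%g)))) W')//.
    rewrite (@reindex_fsbigT _ _ _ G G (fun q => (p * q)%g)); last first.
      by exists (fun q => (p^-1 * q)%g) => q; rewrite ?mulKg ?mulVKg.
    rewrite (fsum_seq uT).
      rewrite (PsiE _ _ uT TH) cmul_sumr; apply: eq_bigr => q _.
      by rewrite phiM mulKg.
    by move=> q qT; rewrite mulKg TH// beta0 cmul0r phi0.
  move=> s sW; rewrite TH ?beta0 ?cmul0r ?phi0//; apply/negP => qT.
  move/negP: sW; apply; rewrite mem_undup mem_cat; apply/orP; right.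
  by apply/allpairsP; exists (p, (p^-1 * s)%g); split => //=; rewrite mulVKg.
have PsiS F : finsupp F -> Psi (cross_star F) = cstar (Psi F).
  move=> Ff; have [S [uS SF]] := finite_support_seq Ff.
  rewrite (PsiE _ _ uS SF) cstar_sum /Psi.
  rewrite (@reindex_fsbigT _ _ _ G G (fun q : G => q^-1%g)); last first.
    by exists (fun q => q^-1%g) => q; rewrite invgK.
  rewrite (fsum_seq uS).
    by apply: eq_bigr => s _; rewrite phiS /cross_star invgK.
  by move=> s /SF Fs; rewrite /cross_star invgK Fs cstar0 beta0 phi0.
have PsiB F : finsupp F -> nrm (Psi F) <= nrm (iota F).
  move=> Ff; have [_ _ univ] := P_crossed.
  by rewrite -lecR -!nrmE; apply: univ => //; split.
have [|||Phi [Pl Pc PE]] := @dense_extension _ P D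
    (fun x y => exists2 F, finsupp F & x = iota F /\ y = Psi F).
- move=> a x x' y y' [F Ff [-> ->]] [H Hf [-> ->]].
  by exists (a *: F + H); [exact: finsuppZD | rewrite crossZD// PsiZD].
- by move=> x y [F Ff [-> ->]]; exact: PsiB.
- move=> x e e0; have [s [F Ff Fs] xs] := cross_dense x e0.
  by exists s => //; exists (Psi F), F.
have Pb : bounded_linear Phi by exact: contractive_bounded.
have PI F : finsupp F -> Phi (iota F) = Psi F by move=> Ff; apply: PE; exists F.
have dW : forall x (e : R), 0 < e -> exists2 s,
    [set s | exists2 F, finsupp F & iota F = s] s & nrm (x - s) < e.
  by move=> x e; exact: cross_dense.
exists Phi; split => //.
  split; first by move=> a x y _ _; exact: (Pl a x y).
    move=> x y _ _ /=.
    (* Multiplicativity spreads by density in two rounds: here in the second factor, then in the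
       first. *)
    have step F : finsupp F -> Phi (cmul (iota F) y) = cmul (Phi (iota F)) (Phi y).
      move=> Ff; apply: (eq_on_dense _ _ dW (f := Phi \o cmul (iota F))
         (g := cmul (Phi (iota F)) \o Phi)).
      - by apply: bounded_linear_comp => //; exact: bounded_linear_mull.
      - by apply: bounded_linear_comp => //; exact: bounded_linear_mull.
      - move=> _ [H Hf <-] /=; rewrite -crossM// !PI//; first by exact: PsiM.
        exact: finsupp_mul.
    apply: (eq_on_dense _ _ dW (f := Phi \o (fun x => cmul x y))
         (g := (fun x => cmul x (Phi y)) \o Phi)).
    - by apply: bounded_linear_comp => //; exact: bounded_linear_mulr.
    - by apply: bounded_linear_comp => //; exact: bounded_linear_mulr.
    - by move=> _ [F Ff <-] /=; exact: step.
  move=> x _ /=; rewrite -[LHS]cstarK; congr cstar.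
  apply: (eq_on_dense _ _ dW (f := fun x => cstar (Phi (cstar x))) (g := Phi)) => //.
    exact: bounded_linear_star.
  move=> _ [F Ff <-] /=; rewrite -crossS// !PI//; last exact: finsupp_star.
  by rewrite PsiS// cstarK.
move=> s a; rewrite /at_group PI; last exact: single_finsupp.
rewrite (PsiE _ [:: s])//.
  by rewrite big_seq1 /single eqxx.
by move=> t; rewrite inE /single => /negPf ->.
Qed.

End CrossedProduct.

(** * The isomorphism *)

Section TensorUnits.
Variables (R : realType) (G : choiceType) (B K T : cstarAlgType R).
Variables (rho : K -> ell2 R G -> ell2 R G) (ten : B -> K -> T).
Hypotheses (K_compact : is_compact_operators rho) (T_tensor : is_cstar_tensor ten).
Variable E : G -> G -> K.
Hypothesis EE : forall p q x, rho (E p q) x = x q *: delta R p.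

Definition tensor_units (p q : G) (b : B) : T := ten b (E p q).

Lemma tensor_zero_r b : ten b 0 = 0.
Proof.
have [[_ h] _ _ _ _] := T_tensor.
by have := h (-1) b 0 0; rewrite scaler0 addr0 scaleN1r addNr.
Qed.

Lemma tensor_nrm b k : nrm (ten b k) = nrm b * nrm k.
Proof.
have [_ _ h _ _] := T_tensor.
by apply: complexI; rewrite rmorphM/= -!nrmE.
Qed.

Lemma tensor_units_nrm p q b : nrm (tensor_units p q b) = nrm b.
Proof. by rewrite tensor_nrm (unit_nrm K_compact EE) mulr1. Qed.

Lemma tensor_units_system : matrix_system tensor_units.
Proof.
have [[h1 _] [h2 h3] _ _ _] := T_tensor; split.
- by move=> p q a b b'; exact: h1.
- move=> p q r s b b'; rewrite /tensor_units h2 (unit_mul K_compact EE).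
  by case: ifP => // _; rewrite tensor_zero_r.
- by move=> p q b; rewrite /tensor_units h3 (unit_star K_compact EE).
- by move=> p q b; rewrite tensor_units_nrm.
Qed.

Lemma tensor_bounded b : bounded_linear (ten b).
Proof.
have [[_ h] _ _ _ _] := T_tensor; split; first by move=> a k k'; exact: h.
by exists (nrm b); [exact: nrm_ge0 | move=> k; rewrite tensor_nrm].
Qed.

Lemma tensor_units_dense x (e : R) : 0 < e ->
  exists2 s, (exists l, s = matrix_sum tensor_units l) & nrm (x - s) < e.
Proof.
move=> e0; have e2 : 0 < e / 2 by rewrite divr_gt0.
have [[h1 h1'] _ _ _ dT] := T_tensor.
have [_ [n [b [k ->]]] xs] := dense_nrm x dT e2.
suff [l ll] : exists l, nrm (\sum_i ten (b i) (k i) - matrix_sum tensor_units l) < e / 2.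
  exists (matrix_sum tensor_units l); first by exists l.
  rewrite (le_lt_trans (nrm_distD (\sum_i ten (b i) (k i)) _ _))//; lra.
(* Dividing by [n.+1] covers [n = 0] and makes the sum of [n] errors strictly smaller than
   [e / 2]. *)
pose d := e / 2 / (n.+1%:R).
have d0 : 0 < d by rewrite divr_gt0.
have step i : exists l, nrm (ten (b i) (k i) - matrix_sum tensor_units l) <= d.
  (* Adding [1] allows division also when [b i] is zero. *)
  have b1 : 0 < nrm (b i) + 1 by have := nrm_ge0 (b i); lra.
  have [F [a Fa]] := matrix_units_dense K_compact EE (k i) (divr_gt0 d0 b1).
  exists [seq ((p, q), a p q *: b i) | p <- F, q <- F].
  have -> : matrix_sum tensor_units [seq ((p, q), a p q *: b i) | p <- F, q <- F] =
      ten (b i) (\sum_(p <- F) \sum_(q <- F) a p q *: E p q).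
    rewrite /matrix_sum big_allpairs_dep/=.
    have [hl _] := tensor_bounded (b i).
    have tD u v : ten (b i) (u + v) = ten (b i) u + ten (b i) v.
      by have := hl 1 u v; rewrite !scale1r.
    rewrite (big_morph (ten (b i)) tD (tensor_zero_r _)); apply: eq_bigr => p _.
    rewrite (big_morph (ten (b i)) tD (tensor_zero_r _)); apply: eq_bigr => q _.
    rewrite /tensor_units.
    have := h1 (a p q) (b i) 0 (E p q); rewrite addr0 => ->.
    have := h1' (a p q) (b i) (E p q) 0; rewrite addr0 => ->.
    have -> : ten 0 (E p q) = 0.
      by have := h1 (-1) 0 0 (E p q); rewrite scaler0 addr0 scaleN1r addNr.
    by rewrite tensor_zero_r.
  have [hl _] := tensor_bounded (b i).
  rewrite -(linear_sub _ _ hl) tensor_nrm.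
  move: Fa; rewrite ltr_pdivlMr//.
  have := nrm_ge0 (k i - \sum_(p <- F) \sum_(q <- F) a p q *: E p q).
  lra.
have /choice[l ll] := step.
exists (flatten [seq l i | i <- index_enum 'I_n]).
have -> : matrix_sum tensor_units (flatten [seq l i | i <- index_enum 'I_n]) =
    \sum_i matrix_sum tensor_units (l i).
  elim: (index_enum 'I_n) => [|i s ih]; first by rewrite /= /matrix_sum !big_nil.
  by rewrite /= matrix_sum_cat ih big_cons.
rewrite -sumrB (le_lt_trans (nrm_sum _ _))//.
rewrite (@le_lt_trans _ _ (\sum_(i < n) d))//; first by apply: ler_sum => i _.
rewrite sumr_const card_ord -[_ *+ n]mulr_natr /d.
have : (n%:R / n.+1%:R : R) < 1.
  by rewrite ltr_pdivrMr// mul1r ltr_nat.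
move=> h; have {}h : e / 2 * (n%:R / n.+1%:R) < e / 2 * 1 by rewrite ltr_pM2l.
by rewrite mulr1 in h; apply: le_lt_trans h; rewrite mulrA mulrAC.
Qed.

End TensorUnits.

(** * Generators of the skew product algebra and maps in both directions *)

Section Duality.
Variables (R : realType) (Q : topologicalType) (X : groupoid Q).
Hypothesis Q_groupoid : topological_groupoid X.
Hypothesis Q_hausdorff : hausdorff_space Q.
Hypothesis Q_r_discrete : r_discrete X.
Variables (G : groupType) (c : Q -> discrete_topology G).
Hypothesis c_continuous : continuous c.
Hypothesis c_hom : groupoid_hom X (c : Q -> G).
Local Notation QG := (Q * discrete_topology G)%type.
Local Notation S := (skew_product c_hom).
Variables (A : cstarAlgType R) (iotaA : (QG -> R[i]^o) -> A).
Hypothesis A_cstar : is_groupoid_cstar S iotaA.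
Variables (B : cstarAlgType R) (iotaB : (Q -> R[i]^o) -> B).
Hypothesis B_cstar : is_groupoid_cstar X iotaB.
Variable beta : G -> A -> A.
Hypothesis beta_action : cstar_action beta.
Hypothesis betaE : forall (s : G) (f : QG -> R[i]^o),
  continuous f -> compactly_supported f ->
  beta s (iotaA f) = iotaA (fun p => f (p.1, ((p.2 : G) * s)%g)).
Implicit Types f h : Q -> R[i]^o.

Let embC p f : Cc f -> Cc (emb c p f) := @emb_Cc R Q Q_hausdorff G c c_continuous p f.
Let convC f h : Cc f -> Cc h -> Cc (gconv X f h) :=
  @gconv_Cc R Q X Q_groupoid Q_hausdorff Q_r_discrete f h.
Let starC f : Cc f -> Cc (fstar X f) := @fstar_Cc R Q X Q_groupoid Q_hausdorff f.
Let fibC f : Cc f -> fibre_finite X f := @Cc_fibre_finite R Q X Q_r_discrete f.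

Lemma skew_fibC (F : QG -> R[i]^o) : Cc F -> fibre_finite S F.
Proof.
by apply: skew_fibre_finite => K cK u; exact: compact_fibre_finite.
Qed.

Lemma beta_emb s p f : Cc f ->
  beta s (iotaA (emb c p f)) = iotaA (emb c (p * s^-1)%g f).
Proof. by move=> fC; have [h1 h2] := embC p fC; rewrite betaE// emb_shift. Qed.

Lemma skew_ind (Pr : (QG -> R[i]^o) -> Prop) :
  Pr 0 -> (forall F H, Cc F -> Cc H -> Pr F -> Pr H -> Pr (F + H)) ->
  (forall p g f, Cc f -> homog c g f -> Pr (emb c p f)) -> forall F, Cc F -> Pr F.
Proof.
move=> P0 PD Pe; apply: (Cc_homog_ind (degree_continuous c_continuous)) => //.
move=> [p g] F FC /degree_emb[Fg ->]; apply: Pe Fg.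
exact: slice_Cc.
Qed.

(** Used below to check the covariance relations and the identity [Psi \o Phi = id] on single matrix
    entries. *)
Lemma emb_generate (D : completeNormedModType R[i]) (u v : A -> D) :
  bounded_linear u -> bounded_linear v ->
  (forall p g f, Cc f -> homog c g f -> u (iotaA (emb c p f)) = v (iotaA (emb c p f))) ->
  u =1 v.
Proof.
move=> ub vb uv; have [ul _] := ub; have [vl _] := vb.
apply: (env_eq A_cstar ub vb); apply: skew_ind => //.
  by rewrite (env0 A_cstar) -(subrr (0 : A)) !linear_sub// !subrr.
move=> F H FC HC uF uH; rewrite (envD A_cstar)//.
by have := ul 1 (iotaA F) (iotaA H); have := vl 1 (iotaA F) (iotaA H);
  rewrite !scale1r uF uH => -> ->.
Qed.

Lemma slice_emb p g f : homog c g f -> slice (g^-1 * p)%g (emb c p f) = f.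
Proof.
move=> fg; apply/funext => x; rewrite /slice embE/=.
have [->|fx] := eqVneq (f x) 0; first by rewrite if_same.
by rewrite [c x](fg _ fx) mulVKg eqxx.
Qed.

Lemma emb_mul p r g f h : Cc f -> homog c g f -> Cc h ->
  cmul (iotaA (emb c p f)) (iotaA (emb c r h)) =
  if g == (p * r^-1)%g then iotaA (emb c p (gconv X f h)) else 0.
Proof.
move=> fC fg hC; rewrite -(envM A_cstar); try exact: embC.
rewrite (emb_conv _ _ _ _ (fibC fC) fg).
by case: ifP => // _; exact: (env0 A_cstar).
Qed.

Lemma emb_adj p g f : Cc f -> homog c g f ->
  cstar (iotaA (emb c p f)) = iotaA (emb c (g^-1 * p)%g (fstar X f)).
Proof.
move=> fC fg; rewrite -(envS A_cstar); last exact: embC.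
by rewrite (emb_star _ _ fg).
Qed.

(** * From the crossed product to matrices *)

Section ToMatrices.
Variables (T : cstarAlgType R) (ta : G -> G -> B -> T).
Hypothesis taS : matrix_system ta.

Let taM p q r s b b' : cmul (ta p q b) (ta r s b') =
        if q == r then ta p s (cmul b b') else 0.
Proof. by case: taS => _ ->. Qed.
Let taV p q b : cstar (ta p q b) = ta q p (cstar b).
Proof. by case: taS => _ _ ->. Qed.

(* On [emb p f], with [f] of degree [g], this is [f (x) e_{p, g^-1 p s}]. *)
Definition matrix_part (s : G) (i : G * G) (F : QG -> R[i]^o) : T :=
  ta i.1 (i.2^-1 * i.1 * s)%g (iotaB (slice (i.2^-1 * i.1)%g F)).

Definition to_matrices (s : G) : (QG -> R[i]^o) -> T :=
  graded_sum (degree c) (matrix_part s).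

Lemma matrix_partZD s i (a : R[i]) (F H : QG -> R[i]^o) : Cc F -> Cc H ->
  matrix_part s i (a *: F + H) = a *: matrix_part s i F + matrix_part s i H.
Proof.
move=> FC HC; rewrite /matrix_part.
have -> : slice (i.2^-1 * i.1)%g (a *: F + H) =
   a *: slice (i.2^-1 * i.1)%g F + slice (i.2^-1 * i.1)%g H by [].
rewrite (envZD B_cstar); try exact: slice_Cc.
by have [h _ _ _] := taS; rewrite h.
Qed.

Lemma to_matricesZD s (a : R[i]) (F H : QG -> R[i]^o) : Cc F -> Cc H ->
  to_matrices s (a *: F + H) = a *: to_matrices s F + to_matrices s H.
Proof.
apply: graded_sumZD; first exact: degree_continuous.
by move=> i b f g; exact: matrix_partZD.
Qed.

Lemma to_matricesD s (F H : QG -> R[i]^o) : Cc F -> Cc H ->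
  to_matrices s (F + H) = to_matrices s F + to_matrices s H.
Proof. by move=> FC HC; have := to_matricesZD s 1 FC HC; rewrite !scale1r. Qed.

Lemma to_matrices0 s : to_matrices s 0 = 0.
Proof.
have := to_matricesZD s (-1) (Cc0 R _) (Cc0 R _).
by rewrite scaler0 addr0 scaleN1r addNr.
Qed.

Lemma to_matrices_emb s p g f : homog c g f ->
  to_matrices s (emb c p f) = ta p (g^-1 * p * s)%g (iotaB f).
Proof.
move=> fg; rewrite /to_matrices (graded_sum_homog _ (emb_degree (p := p) fg)).
  by rewrite /matrix_part slice_emb.
by move=> i b u v; exact: matrix_partZD.
Qed.

(** [to_matrices 1] respects products and adjoints and is therefore bounded by the enveloping norm.
    For other [s] the columns are relabelled by [q |-> q s], which is injective, so the bound
    carries over. *)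
Lemma to_matrices_shift s (F : QG -> R[i]^o) : Cc F ->
  nrm (to_matrices s F) = nrm (to_matrices 1%g F).
Proof.
move=> FC; have [w [uw [wF _]]] := Cc_hpart_sum (degree_continuous c_continuous) FC.
pose l := [seq ((i.1, i.2^-1 * i.1)%g, iotaB (slice (i.2^-1 * i.1)%g (hpart (degree c) i F)))
          | i <- w].
have E t : to_matrices t F = matrix_sum ta [seq ((i.1.1, (i.1.2 * t)%g), i.2) | i <- l].
  rewrite /to_matrices (graded_sumE _ uw wF).
    by rewrite /matrix_sum /l !big_map.
  by move=> i b u v; exact: matrix_partZD.
by rewrite !E !(matrix_sum_shift _ taS (mulIg _)).
Qed.

Lemma to_matrices_mul (F H : QG -> R[i]^o) : Cc F -> Cc H ->
  to_matrices 1%g (gconv S F H) = cmul (to_matrices 1%g F) (to_matrices 1%g H).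
Proof.
(* That the convolution is again in [C_c] is carried through the induction: on generators [emb_conv]
   gives it from the convolution on [Q]. *)
move=> FC HC; suff [] : Cc (gconv S F H) /\
  to_matrices 1%g (gconv S F H) = cmul (to_matrices 1%g F) (to_matrices 1%g H) by [].
move: F FC; apply: skew_ind.
- by rewrite gconv0l to_matrices0 cmul0l; split => //; exact: Cc0.
- move=> F F' FC F'C [c1 e1] [c2 e2].
  rewrite gconvDl; try exact: skew_fibC.
  by split; [exact: CcD | rewrite !to_matricesD// cmulDl e1 e2].
move=> p g f fC fg; move: H HC; apply: skew_ind.
- by rewrite gconv0r to_matrices0 cmul0r; split => //; exact: Cc0.
- move=> H H' HC H'C [c1 e1] [c2 e2].
  rewrite gconvDr; last by apply: skew_fibC; exact: embC.
  by split; [exact: CcD | rewrite !to_matricesD// cmulDr e1 e2].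
move=> r g' h hC hg.
rewrite (emb_conv _ _ _ _ (fibC fC) fg) !(to_matrices_emb _ _ fg) !(to_matrices_emb _ _ hg).
rewrite taM !mulg1.
rewrite mulVg_eq.
case: eqP => [gE|_]; last by rewrite to_matrices0; split => //; exact: Cc0.
split; first by apply: embC; exact: convC.
rewrite (to_matrices_emb _ _ (gconv_homog c_hom fg hg)) (envM B_cstar)//.
by rewrite mulg1 invgM gE invgM invgK -!mulgA mulVg mulg1.
Qed.

Lemma to_matrices_star (F : QG -> R[i]^o) : Cc F ->
  to_matrices 1%g (fstar S F) = cstar (to_matrices 1%g F).
Proof.
move=> FC; suff [] : Cc (fstar S F) /\
  to_matrices 1%g (fstar S F) = cstar (to_matrices 1%g F) by [].
move: F FC; apply: skew_ind.
- by rewrite fstar0 to_matrices0 cstar0; split => //; exact: Cc0.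
- move=> F H FC HC [c1 e1] [c2 e2]; rewrite fstarD.
  by split; [exact: CcD | rewrite !to_matricesD// cstarD e1 e2].
move=> p g f fC fg; rewrite (emb_star _ _ fg).
split; first by apply: embC; exact: starC.
rewrite (to_matrices_emb _ _ fg) (to_matrices_emb _ _ (fstar_homog c_hom fg)).
by rewrite taV (envS B_cstar)// !mulg1 invgK mulVKg.
Qed.

Lemma matrices_covariant : exists phi : G -> A -> T,
  [/\ forall s, bounded_linear (phi s),
      forall s p g f, Cc f -> homog c g f ->
        phi s (iotaA (emb c p f)) = ta p (g^-1 * p * s)%g (iotaB f),
      forall s t a b, cmul (phi s a) (phi t b) = phi (s * t)%g (cmul a (beta s b))
    & forall s a, cstar (phi s a) = phi s^-1%g (beta s^-1%g (cstar a))].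
Proof.
have bound s (F : QG -> R[i]^o) : Cc F -> nrm (to_matrices s F) <= nrm (iotaA F).
  move=> FC; rewrite to_matrices_shift//.
  apply: (env_universal A_cstar) FC.
  - by move=> a f g; exact: to_matricesZD.
  - by move=> f g; exact: to_matrices_mul.
  - by move=> f; exact: to_matrices_star.
have /choice[phi phiP] : forall s, exists phi : A -> T, [/\ linear phi, contractive phi &
    forall F, Cc F -> phi (iotaA F) = to_matrices s F].
  move=> s; apply: (env_extension A_cstar); last exact: bound.
  by move=> a f g; exact: to_matricesZD.
have phib s : bounded_linear (phi s) by have [? ? _] := phiP s; exact: contractive_bounded.
have phiE s p g f : Cc f -> homog c g f ->
    phi s (iotaA (emb c p f)) = ta p (g^-1 * p * s)%g (iotaB f).
  by move=> fC fg; have [_ _ ->] := phiP s; [exact: to_matrices_emb | exact: embC].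
have phi0 s : phi s 0 = 0.
  by have [l _] := phib s; rewrite -(subrr (0 : A)) linear_sub// subrr.
exists phi; split => //.
- move=> s t a b.
  (* First the left factor is a generator and the right one arbitrary; a second density argument
     then frees the left factor. *)
  have step p g f b' : Cc f -> homog c g f ->
      cmul (phi s (iotaA (emb c p f))) (phi t b') =
      phi (s * t)%g (cmul (iotaA (emb c p f)) (beta s b')).
    move=> fC fg.
    apply: (@emb_generate _ (cmul (phi s (iotaA (emb c p f))) \o phi t)
      (phi (s * t)%g \o (cmul (iotaA (emb c p f)) \o beta s))).
    + by apply: bounded_linear_comp => //; exact: bounded_linear_mull.
    + apply: bounded_linear_comp => //; apply: bounded_linear_comp.
        exact: bounded_linear_mull.
      exact: beta_bounded.
    move=> r g' h hC hg /=.
    rewrite !(phiE _ _ _ _ _ fg)// !(phiE _ _ _ _ _ hg)// taM beta_emb// (emb_mul _ _ fC fg hC).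
    (* [beta s] turns row [r] into [r s^-1], so both sides test whether the column [g^-1 p s] equals
       [r]. *)
    rewrite -(mulgA g^-1%g) mulVg_eq invgM invgK mulgA.
    case: eqP => [gE|_]; last by rewrite phi0.
    rewrite (phiE _ _ _ _ (convC fC hC) (gconv_homog c_hom fg hg)) (envM B_cstar)//.
    by congr ta; rewrite invgM gE !invgM !invgK -!mulgA !mulKg.
  apply: (@emb_generate _ ((fun x => cmul x (phi t b)) \o phi s)
    (phi (s * t)%g \o (fun x => cmul x (beta s b)))).
  + by apply: bounded_linear_comp => //; exact: bounded_linear_mulr.
  + by apply: bounded_linear_comp => //; exact: bounded_linear_mulr.
  by move=> p g f fC fg; exact: step fg.
- move=> s a; rewrite -{1}(cstarK a).
  apply: (@emb_generate _ (fun x => cstar (phi s (cstar x)))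
    (phi s^-1%g \o beta s^-1%g)) (cstar a).
  + exact: bounded_linear_star.
  + by apply: bounded_linear_comp => //; exact: beta_bounded.
  move=> p g f fC fg /=.
  rewrite (emb_adj _ fC fg) beta_emb// (phiE _ _ _ _ (starC fC) (fstar_homog c_hom fg)).
  rewrite (phiE _ _ _ _ fC fg) taV (envS B_cstar)// cstarK !invgK.
  by rewrite mulVKg mulgA mulgK.
Qed.

End ToMatrices.

(** * Corners: from matrices to the crossed product *)

Section FromMatrices.
Variables (P : cstarAlgType R) (iotaP : (G -> A) -> P).
Hypothesis P_crossed : is_crossed_product beta iotaP.

Let m := at_group iotaP.

Let mlin s (a : R[i]) x y : m s (a *: x + y) = a *: m s x + m s y.
Proof. exact: (at_groupZD P_crossed). Qed.
Let m0 s : m s 0 = 0.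
Proof. by have := mlin s (-1) 0 0; rewrite scaler0 addr0 scaleN1r addNr. Qed.

(* The copy of [f (x) e_{p, q}] in the crossed product: [f (x) e_{p, g^-1 p}]
   translated by [s] has column [g^-1 p s], so [s = p^-1 g q]. *)
Definition corner_part (p q : G) (g : G) f : P :=
  m (p^-1 * g * q)%g (iotaA (emb c p f)).

Definition corner (p q : G) : (Q -> R[i]^o) -> P := graded_sum c (corner_part p q).

Lemma corner_partZD p q g (a : R[i]) f h : Cc f -> Cc h ->
  corner_part p q g (a *: f + h) = a *: corner_part p q g f + corner_part p q g h.
Proof.
move=> fC hC; rewrite /corner_part embZD (envZD A_cstar); try exact: embC.
exact: mlin.
Qed.

Lemma cornerZD p q (a : R[i]) f h : Cc f -> Cc h ->
  corner p q (a *: f + h) = a *: corner p q f + corner p q h.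
Proof. by apply: graded_sumZD => // g b u v; exact: corner_partZD. Qed.

Lemma cornerD p q f h : Cc f -> Cc h -> corner p q (f + h) = corner p q f + corner p q h.
Proof. by move=> fC hC; have := cornerZD p q 1 fC hC; rewrite !scale1r. Qed.

Lemma corner0 p q : corner p q 0 = 0.
Proof.
by have := cornerZD p q (-1) (Cc0 R _) (Cc0 R _); rewrite scaler0 addr0 scaleN1r addNr.
Qed.

Lemma corner_homog p q g f : homog c g f ->
  corner p q f = m (p^-1 * g * q)%g (iotaA (emb c p f)).
Proof.
move=> fg; rewrite /corner (graded_sum_homog _ fg)//.
by move=> k b u v; exact: corner_partZD.
Qed.

Lemma corner_mul p q r s f h : Cc f -> Cc h ->
  cmul (corner p q f) (corner r s h) =
  if q == r then corner p s (gconv X f h) else 0.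
Proof.
move=> fC hC; move: f fC; apply: (Cc_homog_ind c_continuous).
- by rewrite gconv0l !corner0 cmul0l if_same.
- move=> f f' fC f'C e1 e2; rewrite gconvDl; try exact: fibC.
  rewrite !cornerD//; try exact: convC.
  by rewrite cmulDl e1 e2; case: ifP => // _; rewrite addr0.
move=> g f fC fg; move: h hC; apply: (Cc_homog_ind c_continuous).
- by rewrite gconv0r !corner0 cmul0r if_same.
- move=> h h' hC h'C e1 e2; rewrite gconvDr; last exact: fibC.
  rewrite !cornerD//; try exact: convC.
  by rewrite cmulDr e1 e2; case: ifP => // _; rewrite addr0.
move=> g' h hC hg.
rewrite (corner_homog _ _ fg) (corner_homog _ _ hg) (corner_homog _ _ (gconv_homog c_hom fg hg)).
rewrite /m (at_group_mul beta_action P_crossed) beta_emb// (emb_mul _ _ fC fg hC).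
(* The group element [p^-1 g q] of the left factor moves row [r] to [r q^-1 g^-1 p], which matches
   column [g^-1 p] exactly when [q = r]. *)
have -> : (g == (p * (r * (p^-1 * g * q)^-1)^-1)%g) = (q == r).
  rewrite !invgM !invgK -!mulgA mulVKg -{1}(mulg1 g) (inj_eq (mulgI _)).
  apply/eqP/eqP => [e|->]; last by rewrite mulgV.
  by rewrite -(mul1g r) e -mulgA mulVg mulg1.
case: eqP => [->|_]; last exact: m0.
by congr at_group; rewrite -!mulgA mulVKg.
Qed.

Lemma corner_star p q f : Cc f -> cstar (corner p q f) = corner q p (fstar X f).
Proof.
move: f; apply: (Cc_homog_ind c_continuous).
- by rewrite fstar0 !corner0 cstar0.
- move=> f h fC hC e1 e2; rewrite fstarD !cornerD//; try exact: starC.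
  by rewrite cstarD e1 e2.
move=> g f fC fg; rewrite (corner_homog _ _ fg) (corner_homog _ _ (fstar_homog c_hom fg)).
rewrite /m (at_group_star beta_action P_crossed) (emb_adj _ fC fg) beta_emb; last exact: starC.
rewrite !invgM !invgK; congr (at_group _ _ (iotaA (emb c _ _))).
  by rewrite !mulgA.
by rewrite !mulgA mulgK mulVg mul1g.
Qed.

(** Diagonal corners are *-homomorphisms of [C_c(Q)], hence bounded by the enveloping norm. For an
    off-diagonal corner [y], the element [y^* y] is the diagonal corner at [q] of [f^* f]. *)
Lemma corner_bound p q f : Cc f -> nrm (corner p q f) <= nrm (iotaB f).
Proof.
have diag r h : Cc h -> nrm (corner r r h) <= nrm (iotaB h).
  apply: (env_universal B_cstar).
  - by move=> a u v; exact: cornerZD.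
  - by move=> u v uC vC; rewrite corner_mul// eqxx.
  - by move=> u uC; rewrite corner_star.
move=> fC; rewrite -(@ler_pXn2r _ 2) ?nnegrE ?nrm_ge0// -!nrm_star_mul.
rewrite corner_star// corner_mul ?eqxx//; last exact: starC.
rewrite (le_trans (diag _ _ _))//; first by apply: convC => //; exact: starC.
by rewrite (envM B_cstar)// ?(envS B_cstar)//; exact: starC.
Qed.

Lemma corner_system : exists th : G -> G -> B -> P,
  matrix_system th /\
  forall p q g f, Cc f -> homog c g f ->
    th p q (iotaB f) = m (p^-1 * g * q)%g (iotaA (emb c p f)).
Proof.
have /choice[th thP] : forall pq : G * G, exists t : B -> P,
    [/\ linear t, contractive t & forall f, Cc f -> t (iotaB f) = corner pq.1 pq.2 f].
  move=> [p q]; apply: (env_extension B_cstar) => /=.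
    by move=> a f h; exact: cornerZD.
  by move=> f; exact: corner_bound.
have tb pq : bounded_linear (th pq) by have [? ? _] := thP pq; exact: contractive_bounded.
have tE p q f : Cc f -> th (p, q) (iotaB f) = corner p q f.
  by move=> fC; have [_ _ ->] := thP (p, q).
have t0 pq : th pq 0 = 0.
  by have [l _] := tb pq; rewrite -(subrr (0 : B)) linear_sub// subrr.
exists (fun p q => th (p, q)); split; last first.
  by move=> p q g f fC fg; rewrite tE//; exact: corner_homog.
split.
- by move=> p q; have [] := thP (p, q).
- move=> p q r s b b'.
  (* The relation for [corner] passes to all of [B] in the right factor here and in the left factor
     afterwards. *)
  have step f x : Cc f -> cmul (th (p, q) (iotaB f)) (th (r, s) x) =
      if q == r then th (p, s) (cmul (iotaB f) x) else 0.
    move=> fC; case: ifP => qr; last first.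
      apply: (env_eq B_cstar (f := cmul (th (p, q) (iotaB f)) \o th (r, s))
        (g := fun=> 0)) => [||h hC /=].
      + by apply: bounded_linear_comp => //; exact: bounded_linear_mull.
      + exact: bounded_linear0.
      + by rewrite !tE// corner_mul// qr.
    apply: (env_eq B_cstar (f := cmul (th (p, q) (iotaB f)) \o th (r, s))
      (g := th (p, s) \o cmul (iotaB f))) => [||h hC /=].
    + by apply: bounded_linear_comp => //; exact: bounded_linear_mull.
    + by apply: bounded_linear_comp => //; exact: bounded_linear_mull.
    + by rewrite !tE// corner_mul// qr -(envM B_cstar)// tE//; exact: convC.
  case: ifP => qr; last first.
    apply: (env_eq B_cstar (f := (fun x => cmul x (th (r, s) b')) \o th (p, q))
      (g := fun=> 0)) => [||h hC /=].
    + by apply: bounded_linear_comp => //; exact: bounded_linear_mulr.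
    + exact: bounded_linear0.
    + by rewrite step// qr.
  apply: (env_eq B_cstar (f := (fun x => cmul x (th (r, s) b')) \o th (p, q))
    (g := th (p, s) \o (fun x => cmul x b'))) => [||h hC /=].
  + by apply: bounded_linear_comp => //; exact: bounded_linear_mulr.
  + by apply: bounded_linear_comp => //; exact: bounded_linear_mulr.
  + by rewrite step// qr.
- move=> p q b; rewrite -{1}(cstarK b).
  apply: (env_eq B_cstar (f := fun x => cstar (th (p, q) (cstar x)))
    (g := th (q, p))) (cstar b) => [||h hC /=].
  + exact: bounded_linear_star.
  + exact: tb.
  + rewrite -(envS B_cstar)// !tE//; last exact: starC.
    by rewrite -corner_star// cstarK.
- by move=> p q b; have [_ + _] := thP (p, q); apply.
Qed.

End FromMatrices.
End Duality.

Unset Implicit Arguments.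

Theorem theorem5p9 (R : realType)
  (Q : topologicalType) (X : groupoid Q)
  (Q_groupoid : topological_groupoid X)
  (Q_locally_compact : locally_compact [set: Q])
  (Q_hausdorff : hausdorff_space Q)
  (Q_r_discrete : r_discrete X)
  (Q_amenable : amenable R X)
  (G : groupType)
  (c : Q -> discrete_topology G)
  (c_continuous : continuous c)
  (c_hom : groupoid_hom X (c : Q -> G))
  (* C^*(Q x_c G) *)
  (A : cstarAlgType R) (iotaA : (Q * discrete_topology G -> R[i]^o) -> A)
  (A_cstar : is_groupoid_cstar (skew_product c_hom) iotaA)
  (beta : G -> A -> A)
  (beta_action : cstar_action beta)
  (betaE : forall (s : G) (f : Q * discrete_topology G -> R[i]^o),
     continuous f -> compactly_supported f ->
     beta s (iotaA f) = iotaA (fun p => f (p.1, ((p.2 : G) * s)%g)))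
  (* C^*(Q x_c G) x_beta G *)
  (P : cstarAlgType R) (iotaP : (G -> A) -> P)
  (P_crossed : is_crossed_product beta iotaP)
  (* C^*(Q) *)
  (B : cstarAlgType R) (iotaB : (Q -> R[i]^o) -> B)
  (B_cstar : is_groupoid_cstar X iotaB)
  (* K(l^2(G)) *)
  (K : cstarAlgType R) (rho : K -> ell2 R G -> ell2 R G)
  (K_compact : is_compact_operators rho)
  (* C^*(Q) (x) K(l^2(G)) *)
  (T : cstarAlgType R) (ten : B -> K -> T)
  (T_tensor : is_cstar_tensor ten) :
  cstar_isomorphic P T.
Proof.
have [E EE] := matrix_units_exist K_compact.
pose ta := tensor_units ten E.
have taS : matrix_system ta := tensor_units_system K_compact T_tensor EE.
have tan p q b : nrm (ta p q b) = nrm b := tensor_units_nrm K_compact T_tensor EE p q b.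
have tad x (e : R) : 0 < e -> exists2 s, (exists l, s = matrix_sum ta l) & nrm (x - s) < e.
  exact: (tensor_units_dense K_compact T_tensor EE).
have [phi [phib phiE phiM phiS]] := matrices_covariant Q_groupoid Q_hausdorff
  Q_r_discrete c_continuous A_cstar B_cstar beta_action betaE taS.
have [|Phi [PhiH Phib PhiE]] := cross_extension beta_action P_crossed _ phiM phiS.
  by move=> s; have [] := phib s.
have [th [thS thE]] := corner_system Q_groupoid Q_hausdorff
  Q_r_discrete c_continuous A_cstar B_cstar beta_action betaE P_crossed.
(* [Psi] sends a finite matrix in [T] to the same list read in the crossed product; different lists
   may give the same element of [T], and [matrix_system_contraction] shows that the value agrees. As
   [Phi] is already a *-homomorphism, a linear contraction inverse to it suffices. *)
have [|||Psi [Psil Psic PsiE]] := @dense_extension _ T P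
    (fun x y => exists l, x = matrix_sum ta l /\ y = matrix_sum th l).
- move=> a x x' y y' [l [-> ->]] [l' [-> ->]].
  exists ([seq (i.1, a *: i.2) | i <- l] ++ l').
  by rewrite !matrix_sum_cat !matrix_sum_scale.
- by move=> x y [l [-> ->]]; exact: matrix_system_contraction.
- move=> x e e0; have [s [l sl] xs] := tad x e e0.
  by exists s => //; exists (matrix_sum th l), l.
have Psib : bounded_linear Psi := contractive_bounded Psil Psic.
have one (D : cstarAlgType R) (v : G -> G -> B -> D) p q b :
    matrix_sum v [:: ((p, q), b)] = v p q b by rewrite /matrix_sum big_seq1.
have Psi_ta p q b : Psi (ta p q b) = th p q b.
  by apply: PsiE; exists [:: ((p, q), b)]; rewrite !one.
have system_bounded (D : cstarAlgType R) (v : G -> G -> B -> D) p q :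
    matrix_system v -> bounded_linear (v p q).
  by move=> [l _ _ n]; apply: contractive_bounded => // b; exact: n.
have PhiD x y : Phi (x + y) = Phi x + Phi y.
  by have [l _] := Phib; have := l 1 x y; rewrite !scale1r.
have Phi0 : Phi 0 = 0.
  by have [l _] := Phib; rewrite -(subrr (0 : P)) linear_sub// subrr.
have Phi_th p q b : Phi (th p q b) = ta p q b.
  apply: (env_eq B_cstar (f := Phi \o th p q) (g := ta p q)).
  - by apply: bounded_linear_comp => //; exact: system_bounded.
  - exact: system_bounded.
  apply: (Cc_homog_ind c_continuous).
  - by rewrite (env0 B_cstar) /= !matrix_system0.
  - move=> f h fC hC /= e1 e2.
    by rewrite (envD B_cstar)// !matrix_systemD// PhiD e1 e2.
  - move=> g f fC fg /=; rewrite (thE _ _ _ _ fC fg) PhiE (phiE _ _ _ _ fC fg).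
    (* The translation [s = p^-1 g q] was chosen so that the column [g^-1 p s] is [q]. *)
    by congr ta; rewrite -!mulgA mulVKg mulKg.
exists Phi; split => //; exists Psi => x.
- apply: (cross_eq P_crossed (f := Psi \o Phi) (g := id)).
  + exact: bounded_linear_comp.
  + exact: bounded_linear_id.
  move=> s a /=.
  apply: (emb_generate Q_hausdorff c_continuous A_cstar
    (u := Psi \o (Phi \o at_group iotaP s)) (v := at_group iotaP s)).
  + apply: bounded_linear_comp => //; apply: bounded_linear_comp => //.
    exact: (at_group_bounded beta_action P_crossed).
  + exact: (at_group_bounded beta_action P_crossed).
  move=> p g f fC fg /=; rewrite PhiE (phiE _ _ _ _ fC fg) Psi_ta (thE _ _ _ _ fC fg).
  (* Conversely, for the column [q = g^-1 p s] the translation [p^-1 g q] is [s] again. *)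
  by congr at_group; rewrite -!mulgA mulVKg mulKg.
- apply: (eq_on_dense _ _ (fun x e => @tad x e) (f := Phi \o Psi) (g := id)).
  + exact: bounded_linear_comp.
  + exact: bounded_linear_id.
  move=> _ [l ->] /=; rewrite (PsiE _ (matrix_sum th l)); last by exists l.
  rewrite /matrix_sum (big_morph Phi PhiD Phi0); apply: eq_bigr => i _.
  exact: Phi_th.
Qed.
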